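(* There are absolute constants $C, C' > 0$ such that for every integer $k \geqslant 1$ and every connected $k$-apex graph $G = (V,E)$, $$\mathrm{xc}(P_{\mathrm{sp.trees}}(G)) \leqslant C\, k\, |E| \leqslant C'\, k^2\, |V|.$$
   Context: All graphs are simple, finite and undirected. A graph $G=(V,E)$ is $k$-apex if there is a set $X \subseteq V$ with $|X| \leqslant k$ such that $G - X$ (the graph obtained by deleting the vertices of $X$) is planar. For a connected graph $G=(V,E)$, the spanning tree polytope is $P_{\mathrm{sp.trees}}(G) = \mathrm{conv}\{\chi^T \in \{0,1\}^E \mid T \subseteq E,\ T \text{ is (the edge set of) a spanning tree of } G\} \subseteq \mathbb{R}^E$, where $\chi^T$ is the characteristic vector of $T$. An extended formulation of a polytope $P \subseteq \mathbb{R}^d$ is a linear system $Ax + By \leqslant b,\ Cx + Dy = c$ in variables $x \in \mathbb{R}^d$ and $y \in \mathbb{R}^m$ (for some $m$) such that $P = \{x \in \mathbb{R}^d \mid \exists y \in \mathbb{R}^m : Ax + By \leqslant b,\ Cx + Dy = c\}$. Its size is its number of inequalities (equalities are not counted). The extension complexity $\mathrm{xc}(P)$ is the minimum size of an extended formulation of $P$. *)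

(* Defs.v *)
From HB Require Import structures.
From mathcomp Require Import all_boot all_order all_algebra.
From mathcomp Require Import all_classical all_reals all_analysis.

Set Implicit Arguments.
Unset Strict Implicit.
Unset Printing Implicit Defensive.

Import Order.TTheory GRing.Theory Num.Theory.
Import numFieldNormedType.Exports.

Local Open Scope classical_set_scope.
Local Open Scope ring_scope.

Record sgraph := SGraph {
  svertex :> finType;
  sedge : rel svertex;
  sedge_sym : symmetric sedge;
  sedge_irrefl : irreflexive sedge
}.

Definition edges (G : sgraph) : {set {set G}} :=
  [set [set xy.1; xy.2]%SET | xy in [pred xy : G * G | sedge xy.1 xy.2]]%SET.

Section Deletion.
Variables (G : sgraph) (X : {set G}).

Let del_rel (x y : {x : G | x \notin X}) : bool := sedge (val x) (val y).

Fact del_sym : symmetric del_rel.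
Proof. by move=> x y; exact: sedge_sym. Qed.

Fact del_irrefl : irreflexive del_rel.
Proof. by move=> x; exact: sedge_irrefl. Qed.

Definition del_vertices : sgraph := SGraph del_sym del_irrefl.

End Deletion.

(* Drawings in the plane [R * R] with arbitrary continuous arcs.
   [arc] is only constrained on edges: the arc drawn for [e] is the image of
   the unit interval under [arc e], in an arbitrary direction. *)
Record plane_drawing (R : realType) (G : sgraph)
    (pos : G -> R * R) (arc : {set G} -> R -> R * R) : Prop := PlaneDrawing {
  pos_inj : injective pos;
  arc_cont : forall e, e \in edges G -> {within `[0, 1], continuous (arc e)};
  arc_inj : forall e, e \in edges G -> {in `[0, 1]%R &, injective (arc e)};
  arc_ends : forall e, e \in edges G ->
    [set arc e 0; arc e 1] = pos @` [set` e];
  arc_vertex : forall e, e \in edges G ->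
    arc e @` `]0, 1[ `&` range pos = set0;
  arc_disj : forall e f, e \in edges G -> f \in edges G -> e != f ->
    arc e @` `]0, 1[ `&` arc f @` `[0, 1] = set0
}.

Arguments plane_drawing {R} G pos arc.

Definition planar (R : realType) (G : sgraph) : Prop :=
  exists (pos : G -> R * R) (arc : {set G} -> R -> R * R),
    plane_drawing G pos arc.

Definition apex (R : realType) (k : nat) (G : sgraph) : Prop :=
  exists X : {set G}, (#|X| <= k)%N /\ planar R (del_vertices X).

Definition joined (G : sgraph) (T : {set {set G}}) : rel G :=
  [rel x y | (x != y) && ([set x; y]%SET \in T)].

Definition is_connected (G : sgraph) : Prop :=
  forall x y : G, connect (@sedge G) x y.

Definition spanning_tree (G : sgraph) (T : {set {set G}}) : Prop :=
  [/\ T \subset edges G,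
      forall x y : G, connect (joined T) x y &
      forall p : seq G, (2 < size p)%N -> ~ ucycle (joined T) p].

(* Coordinates of R^E follow the canonical enumeration of the edge set. *)
Definition char_vector (R : realType) (G : sgraph) (T : {set {set G}}) :
    'cV[R]_#|edges G| :=
  \col_i (enum_val i \in T)%:R.

Definition conv (R : realType) (d : nat) (S : set 'cV[R]_d) : set 'cV[R]_d :=
  smallest (@convex_set R (convex_lmodType 'cV[R]_d)) S.

Definition sp_trees_polytope (R : realType) (G : sgraph) :
    set 'cV[R]_#|edges G| :=
  conv [set char_vector R T | T in @spanning_tree G].

(* [r] counts the inequalities; the [q] equations and the [m] additional
   variables are free of charge. *)
Definition has_extended_formulation (R : realType) (d : nat)
    (P : set 'cV[R]_d) (r : nat) : Prop :=
  exists (m q : nat)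
         (A : 'M[R]_(r, d)) (B : 'M[R]_(r, m)) (b : 'cV[R]_r)
         (C : 'M[R]_(q, d)) (D : 'M[R]_(q, m)) (c : 'cV[R]_q),
    P = [set x | exists y : 'cV[R]_m,
           (forall i, (A *m x + B *m y) i 0 <= b i 0) /\
           C *m x + D *m y = c].

(* As the possible sizes are natural numbers, this infimum is a minimum as soon
   as [P] has an extended formulation; it is [+oo] if there is none. *)
Definition xc (R : realType) (d : nat) (P : set 'cV[R]_d) : \bar R :=
  ereal_inf [set r%:R%:E | r in has_extended_formulation P].

Arguments sp_trees_polytope R G : clear implicits.

(* Main.v *)
Require Import Defs.
From mathcomp Require Import all_boot all_order all_algebra.
From mathcomp Require Import all_classical all_reals all_analysis.
From mathcomp Require Import fintype finset.
From mathcomp Require Import ring lra zify.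

(** By Edmonds, the spanning tree polytope of a connected graph [G] consists of
    the [x >= 0] with [x(E) = |V| - 1] and [x(E(S)) <= |S| - 1] for every
    nonempty set [S] of vertices ([spanning_tree_polytope]); orientations
    certify these exponentially many bounds cheaply.

    Martin: fix a root [r], and dominate [x] by a sum of two nonnegative
    vectors, one for each direction of the edges, such that every vertex has
    outflow one, except [r], which has outflow zero.  Adding up the outflows of
    the vertices of [S] gives the bound for every [S] that contains [r]
    ([rooted_bound]), and a spanning tree satisfies this, once oriented towards
    [r] ([tree_parents]).  With [k] apices as roots, [3k|E|] inequalities settle
    all sets that meet the apex set [X].

    Williams: the other sets live in the planar graph [G - X], where a single
    root suffices if a dual tree is guessed as well.  Besides the primal arcs
    there are two dual arcs per edge, every face but a root face has dual
    outflow one, and the four arcs of an edge have total capacity one.  If the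
    root face touches the root vertex, the bounds hold for all [S], since
    Euler's formula counts the edges enclosed by [S] ([williams_sound]).
    Conversely, a forest extends to a spanning tree, and the edges outside this
    tree connect the dual graph ([williams_complete]).

    Both arguments use planarity only through four properties, over the field
    with two elements, of a map that gives each edge two sides ([plane_dual]):
    boundaries of sets of faces are cycles, cycles are boundaries of sets of
    faces, the dual graph is connected, and the faces around a vertex are
    connected through its edges.  They come from a drawing with arbitrary
    continuous arcs without the Jordan curve theorem.  By compactness the arcs
    keep a positive distance from each other away from the vertices, so on a
    fine grid they become walks that are disjoint outside disjoint boxes around
    the vertices ([grid_drawing]): [G - X] is a minor of a grid.  For a grid the
    properties are explicit; a cycle bounds the cells above an odd number of its
    edges ([torus_cycle]).  Minors inherit them: contract a forest [K], and
    merge the faces along the deleted edges ([minor_dual]).  Choosing [K]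
    maximal makes the minor a connected simple graph on the vertices of [G - X]
    that contains [G - X].  It has at most [3(|V| - 1)] edges
    ([planar_edge_bound]), which bounds the size of Williams' formulation and
    yields [|E| <= (k + 3)|V|], the second inequality.

    Forests are handled algebraically: [K] is a forest if it supports no nonzero
    chain with zero boundary ([indep]), and spanning trees are maximal such sets
    ([extend_indep]). *)

Set Implicit Arguments.
Unset Strict Implicit.
Unset Printing Implicit Defensive.

Import Order.TTheory GRing.Theory Num.Theory.
Import numFieldNormedType.Exports.

Local Open Scope ring_scope.

(** * Chains, forests and orientations of multigraphs *)

Lemma addF2 (x : 'F_2) : x + x = 0.
Proof. by case: x => -[|[|]] // i; apply/val_inj. Qed.

Lemma F2_neq0 (x : 'F_2) : x != 0 -> x = 1.
Proof. by case: x => -[|[|]] // i _; apply/val_inj. Qed.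

Lemma F2_natr_addb (p q : bool) : (p%:R + q%:R : 'F_2) = (p (+) q)%:R.
Proof. by case: p q => -[]; rewrite ?addF2 ?addr0 ?add0r. Qed.

Lemma addF2_eq0 (x y : 'F_2) : (x + y == 0) = (x == y).
Proof. by rewrite -{1}(addNr y) -subr_eq0 opprD opprK addrA addrK; case: x y => -[|[|]] // i [] [|[|]]. Qed.

Section Multigraph.
Variables (V E : finType) (a b : E -> V).
Implicit Types (K R : {set E}) (B C : {set V}) (z : E -> 'F_2) (v : V).

Definition adj K : rel V := fun x y =>
  [exists e in K, ((a e == x) && (b e == y)) || ((a e == y) && (b e == x))].

(** Boundary of a chain, modulo two; a loop has boundary zero. *)
Definition bd z v : 'F_2 := \sum_e z e * ((a e == v)%:R + (b e == v)%:R).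

Definition supported K z := forall e, e \notin K -> z e = 0.

(** Relative forests: after identifying the vertices of [B] to one vertex, [K] has no
    cycle.  For [B] empty or a single vertex these are the forests. *)
Definition indep B K := forall z, supported K z ->
  (forall v, v \notin B -> bd z v = 0) -> forall e, z e = 0.

Lemma adj_sym K : symmetric (adj K).
Proof. by move=> x y; apply/exists_inP/exists_inP=> -[e eK h]; exists e; rewrite // orbC. Qed.

Lemma adj_connect_sym K : connect_sym (adj K).
Proof. exact/sym_connect_sym/adj_sym. Qed.

Lemma adj_edge K e : e \in K -> adj K (a e) (b e).
Proof. by move=> eK; apply/exists_inP; exists e; rewrite ?eqxx. Qed.

Lemma sub_connect_adj K R : K \subset R ->
  subrel (connect (adj K)) (connect (adj R)).
Proof.
move=> /subsetP KR; apply: connect_sub => x y /exists_inP[e /KR eR h].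
by apply/connect1/exists_inP; exists e.
Qed.

Lemma closed_connect K C : (forall e, e \in K -> (a e \in C) = (b e \in C)) ->
  forall x y, connect (adj K) x y -> (x \in C) = (y \in C).
Proof.
move=> clC x y /connectP[p + ->]; elim: p x => //= w p IH x /andP[+ /IH <-].
by move=> /exists_inP[e /clC h] /orP[]/andP[/eqP <- /eqP <-].
Qed.

Lemma bdD z z' v : bd (fun e => z e + z' e) v = bd z v + bd z' v.
Proof. by rewrite -big_split; apply: eq_bigr => e _; rewrite mulrDl. Qed.

Lemma bd_delta e v :
  bd (fun e' => (e' == e)%:R) v = (a e == v)%:R + (b e == v)%:R.
Proof.
rewrite /bd (bigD1 e) //= eqxx mul1r big1 ?addr0 // => i /negbTE ->.
by rewrite mul0r.
Qed.

Lemma bd0 v : bd (fun=> 0) v = 0.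
Proof. by apply: big1 => e _; rewrite mul0r. Qed.

(** Adding up the edges of a walk, all inner vertices cancel modulo two. *)
Lemma connect_chain K x y : connect (adj K) x y ->
  exists2 z, supported K z & forall v, bd z v = (x == v)%:R + (y == v)%:R.
Proof.
move=> /connectP[p + ->]; elim: p x => [|w p IH] x /=.
  by move=> _; exists (fun=> 0) => // v; rewrite bd0 addF2.
move=> /andP[/exists_inP[e eK h] /IH[z zK bz]].
exists (fun e' => z e' + (e' == e)%:R).
  move=> e' e'K; rewrite zK // add0r; case: eqP => // ee.
  by rewrite ee eK in e'K.
move=> v; rewrite bdD bd_delta bz addrC.
have -> : (a e == v)%:R + (b e == v)%:R = (x == v)%:R + (w == v)%:R :> 'F_2.
  by case/orP: h => /andP[/eqP -> /eqP ->] //; rewrite addrC.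
by rewrite addrA -(addrA (x == v)%:R) addF2 addr0.
Qed.

(** Double counting: an edge contributes once for each of its ends in [C]. *)
Lemma sum_bd C z : \sum_(v in C) bd z v =
  \sum_e z e * ((a e \in C)%:R + (b e \in C)%:R).
Proof.
rewrite exchange_big /=; apply: eq_bigr => e _.
rewrite -mulr_sumr big_split /=; congr (_ * (_ + _)).
  case: (boolP (_ \in C)) => h; last first.
    by rewrite big1 // => v vC; case: eqP h => // ->; rewrite vC.
  by rewrite (bigD1 (a e)) //= eqxx big1 ?addr0 // => v /andP[_]; rewrite eq_sym => /negbTE ->.
case: (boolP (_ \in C)) => h; last first.
  by rewrite big1 // => v vC; case: eqP h => // ->; rewrite vC.
by rewrite (bigD1 (b e)) //= eqxx big1 ?addr0 // => v /andP[_]; rewrite eq_sym => /negbTE ->.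
Qed.

Lemma sum_bd_closed K C z : supported K z ->
  (forall e, e \in K -> (a e \in C) = (b e \in C)) -> \sum_(v in C) bd z v = 0.
Proof.
move=> zK clC; rewrite sum_bd big1 // => e _.
case: (boolP (e \in K)) => [/clC ->|/zK ->]; last by rewrite mul0r.
by rewrite addF2 mulr0.
Qed.

Lemma indep0 B : indep B set0.
Proof. by move=> z z0 _ e; apply: z0; rewrite inE. Qed.

(** The total boundary of a chain vanishes, so a boundary cannot consist of one vertex. *)
Lemma indep_root r K : indep set0 K -> indep [set r] K.
Proof.
move=> indK z zK bz; apply: indK => // v _.
have [vr|] := eqVneq v r; last by move=> vr; apply: bz; rewrite inE.
have := sum_bd_closed (C := [set: V]) zK (fun e _ => etrans (in_setT _) (esym (in_setT _))).
rewrite (bigD1 r) ?inE //= big1 ?addr0 ?vr // => w /andP[_ wr].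
by apply: bz; rewrite inE.
Qed.

(** What it means for [e] to depend on [K] after identifying the vertices of [B]. *)
Definition spans B K e := connect (adj K) (a e) (b e) \/
  (exists2 u, u \in B & connect (adj K) (a e) u) /\
  (exists2 u, u \in B & connect (adj K) (b e) u).

(** A maximal relative forest depends on each edge [e] of [R]: a chain through [e] with
    boundary in [B] has boundary sum one on the [K]-component of an end of [e],
    unless this component contains the other end, so it contains a vertex of [B]. *)
Lemma extend_indep B K0 R : K0 \subset R -> indep B K0 ->
  exists K, [/\ K0 \subset K, K \subset R, indep B K &
               forall e, e \in R -> spans B K e].
Proof.
move=> K0R iK0.
pose P := [pred K : {set E} | (K \subset R) && `[< indep B K >]].
have PK0 : P K0 by rewrite /= K0R; apply/asboolP.
have [K /maxsetP[/andP[KR /asboolP iK] maxK] K0K] := maxset_exists PK0.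
exists K; split=> // e eR.
have [eK|eK] := boolP (e \in K); first by left; exact/connect1/adj_edge.
have /existsNP[z /not_implyP[zK /not_implyP[bz /existsNP[e0 ze0]]]] :
    ~ indep B (e |: K).
  move=> iK'; have /maxK K'K : P (e |: K).
    by rewrite /= subUset sub1set eR KR; apply/asboolP.
  by move: eK; rewrite -K'K ?setU11 ?subsetUr.
have ze : z e = 1.
  apply: F2_neq0; apply/eqP => ze; apply: ze0; apply: iK => // e' e'K.
  have [->//|ne] := eqVneq e' e.
  by apply: zK; rewrite !inE negb_or ne.
have [cab|ncab] := boolP (connect (adj K) (a e) (b e)); first by left.
right.
have key x : ((a e \in [set v | connect (adj K) x v])%:R +
              (b e \in [set v | connect (adj K) x v])%:R = 1 :> 'F_2) ->
    exists2 u, u \in B & connect (adj K) x u.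
  move=> h; apply/not_notP => no.
  have : \sum_(v in [set v | connect (adj K) x v]) bd z v = 0.
    apply: big1 => v; rewrite inE => xv; apply: bz.
    by apply/negP => vB; apply: no; exists v.
  rewrite sum_bd (bigD1 e) //= h ze mul1r big1 ?addr0 // => e' ne.
  have [e'K|e'K] := boolP (e' \in K); last first.
    by rewrite zK ?mul0r // !inE negb_or ne.
  rewrite !inE (same_connect_r (@adj_connect_sym K) (connect1 (adj_edge e'K))).
  by rewrite addF2 mulr0.
split; apply: key; rewrite !inE connect0.
  by rewrite (negbTE ncab) addr0.
by rewrite adj_connect_sym (negbTE ncab) add0r.
Qed.

Lemma spans_connect B K R : (forall e, e \in R -> spans B K e) ->
  forall x u, u \in B -> connect (adj R) x u ->
  exists2 w, w \in B & connect (adj K) x w.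
Proof.
move=> sp x u uB /connectP[p + pu]; elim: p x pu => [|w p IH] x /= pu.
  by move=> _; exists u => //; rewrite pu connect0.
move=> /andP[/exists_inP[e /sp eR h] /(IH _ pu)[w' w'B ww']].
case/orP: h => /andP[/eqP ea /eqP eb]; case: eR => [c|[c1 c2]]; rewrite -?ea -?eb //.
  by exists w'; rewrite // (connect_trans c) // eb.
by exists w'; rewrite // adj_connect_sym (connect_trans _ c) // ea adj_connect_sym.
Qed.

Lemma spans_connect0 K R : (forall e, e \in R -> spans set0 K e) ->
  subrel (connect (adj R)) (connect (adj K)).
Proof.
move=> sp; apply: connect_sub => x y /exists_inP[e /sp eR h].
have c : connect (adj K) (a e) (b e) by case: eR => [//|[[u]]]; rewrite inE.
by case/orP: h => /andP[/eqP <- /eqP <-]; rewrite // adj_connect_sym.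
Qed.

(** Outflow of [v], where [pa e] and [pb e] flow along [e] out of its ends [a e] and [b e]. *)
Definition out (R : nmodType) (pa pb : E -> R) v :=
  \sum_(e | a e == v) pa e + \sum_(e | b e == v) pb e.

(** Each vertex outside [B] sends one unit along an edge towards [B].  Induction on the
    number of these vertices: an edge that leaves [B] serves its outer end, which then
    joins the targets.  As targets send nothing, the induction has not used that edge. *)
Lemma parents B K :
  (forall x, exists2 u, u \in B & connect (adj K) x u) ->
  exists pa pb : E -> nat,
    (forall e, pa e + pb e <= (e \in K))%N /\
    (forall v, out pa pb v = (v \notin B) :> nat).
Proof.
have [n] := ubnP #|~: B|; elim: n B => // n IH B ltn toB.
have [full|/set0Pn[x]] := eqVneq (~: B) set0.
  exists (fun=> 0%N), (fun=> 0%N); split=> // v; rewrite /out !big1 // addr0.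
  by have := in_set0 v; rewrite -full inE => ->.
rewrite inE => xB.
have [e [eK eB]] : exists e, e \in K /\ (a e \in B) != (b e \in B).
  apply/not_existsP => no; have [u uB xu] := toB x; move: xB.
  rewrite (closed_connect (C := B) _ xu) ?uB // => e eK.
  by have := no e; case: (eqVneq (a e \in B) (b e \in B)) => // ne [].
have main (y : V) : y \notin B -> (y == a e) || (y == b e) ->
    exists pa pb : E -> nat,
    [/\ (forall e, pa e + pb e <= (e \in K))%N,
     (forall v, out pa pb v = (v \notin y |: B) :> nat) & (pa e = 0 /\ pb e = 0)%N].
  move=> yB ye.
  have [||pa [pb [le_p out_p]]] := IH (y |: B).
  - rewrite -ltnS (leq_trans _ ltn) // ltnS proper_card // properC.
    by rewrite properUr // sub1set.
  - by move=> w; have [u uB wu] := toB w; exists u; rewrite // !inE uB orbT.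
  exists pa, pb; split=> //.
  have [aB bB] : a e \in y |: B /\ b e \in y |: B.
    rewrite !inE; case/orP: ye yB eB => /eqP -> /negbTE ->; rewrite eqxx.
      by case: (b e \in B); rewrite ?orbT.
    by case: (a e \in B); rewrite ?orbT.
  split.
    have := out_p (a e); rewrite aB /out (bigD1 e) //= => /eqP.
    by rewrite -addrA addn_eq0 => /andP[/eqP].
  have := out_p (b e); rewrite bB /out [X in _ + X](bigD1 e) //= => /eqP.
  by rewrite addrCA addn_eq0 => /andP[/eqP].
have [aB|aB] := boolP (a e \in B).
  have bB : b e \notin B by move: eB; rewrite aB; case: (_ \in B).
  have [pa [pb [le_p out_p [pae pbe]]]] := main _ bB (introT orP (or_intror (eqxx _))).
  exists pa, (fun e' => pb e' + (e' == e))%N; split=> [e'|v].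
    have [->|_] := eqVneq e' e; last by rewrite addn0.
    by rewrite pae pbe eK.
  rewrite /out big_split /= addrA -/(out pa pb v) out_p !inE negb_or.
  have -> : (\sum_(i | b i == v) (i == e) = (b e == v) :> nat)%N.
    have [<-|ne] := eqVneq (b e) v.
      by rewrite (bigD1 e) //= eqxx big1 // => i /andP[_ /negbTE ->].
    by rewrite big1 // => i; have [->|//] := eqVneq i e; rewrite (negbTE ne).
  have [<-|ne] := eqVneq (b e) v; first by rewrite bB.
  by rewrite addr0.
have bB : b e \in B by move: eB; rewrite (negbTE aB); case: (_ \in B).
have [pa [pb [le_p out_p [pae pbe]]]] := main _ aB (introT orP (or_introl (eqxx _))).
exists (fun e' => pa e' + (e' == e))%N, pb; split=> [e'|v].
  have [->|_] := eqVneq e' e; last by rewrite addn0.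
  by rewrite pae pbe eK.
rewrite /out big_split /= addrAC -/(out pa pb v) out_p !inE negb_or.
have -> : (\sum_(i | a i == v) (i == e) = (a e == v) :> nat)%N.
  have [<-|ne] := eqVneq (a e) v.
    by rewrite (bigD1 e) //= eqxx big1 // => i /andP[_ /negbTE ->].
  by rewrite big1 // => i; have [->|//] := eqVneq i e; rewrite (negbTE ne).
have [<-|ne] := eqVneq (a e) v; first by rewrite aB.
by rewrite addr0.
Qed.

Lemma sum_out (M : nmodType) (pa pb : E -> M) :
  \sum_v out pa pb v = \sum_e (pa e + pb e).
Proof.
rewrite !big_split /=; congr (_ + _).
  by rewrite [RHS](partition_big a xpredT).
by rewrite [RHS](partition_big b xpredT).
Qed.


(** Chains on a relative forest are determined by their boundaries outside [B]; the bound
    compares the numbers of chains and of possible boundaries. *)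
Lemma indep_card B K : indep B K -> (#|K| <= #|~: B|)%N.
Proof.
move=> iK.
pose ext (y : {ffun {e | e \in K} -> 'F_2}) e := if insub e is Some i then y i else 0.
have ext_in y i : ext y (val i) = y i by rewrite /ext valK.
have ext_out y : supported K (ext y) by move=> e eK; rewrite /ext insubN.
pose f y := [ffun v : {v | v \in ~: B} => bd (ext y) (val v)].
have f_inj : injective f.
  move=> y y' /ffunP fyy'; apply/ffunP => i; rewrite -!ext_in; apply/eqP.
  rewrite -addF2_eq0; apply/eqP; apply: (iK (fun e => ext y e + ext y' e)).
    by move=> e eK; rewrite !ext_out // addr0.
  move=> v vB; rewrite bdD; have vB' : v \in ~: B by rewrite inE.
  by have := fyy' (exist _ v vB'); rewrite !ffunE /= => ->; rewrite addF2.
have := leq_card f f_inj; rewrite !card_ffun !card_sig card_Fp // leq_exp2l //.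
Qed.

(** A cycle through [e] would have boundary sum one on the component of [a e] in [K :\ e]
    if [b e] were not in it. *)
Lemma cycle_edge_connect K z e : supported K z -> (forall v, bd z v = 0) -> z e != 0 ->
  connect (adj (K :\ e)) (a e) (b e).
Proof.
move=> zK bz ze; pose C := [set v | connect (adj (K :\ e)) (a e) v].
have : \sum_(v in C) bd z v = 0 by apply: big1 => v _; exact: bz.
rewrite sum_bd (bigD1 e) //= big1 => [|e' ne].
  rewrite addr0 (F2_neq0 ze) mul1r !inE connect0 => /eqP; rewrite addF2_eq0.
  by case: (connect _ _ (b e)).
have [e'K|e'K] := boolP (e' \in K); last by rewrite zK // mul0r.
rewrite !inE (same_connect_r (@adj_connect_sym _) (connect1 (_ : adj _ (a e') (b e')))).
  by rewrite addF2 mulr0.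
by apply: adj_edge; rewrite !inE ne.
Qed.

Lemma sum_notin B : (\sum_v (v \notin B : nat) = #|~: B|)%N.
Proof.
by rewrite -big_mkcond -sum1_card; apply: eq_bigl => v; rewrite inE.
Qed.

(** A relative forest has at most as many edges as there are vertices outside [B], each of
    which sends one unit: so no edge is left out. *)
Lemma tree_parents B K : indep B K ->
  (forall x, exists2 u, u \in B & connect (adj K) x u) ->
  exists pa pb : E -> nat,
    (forall e, pa e + pb e = (e \in K))%N /\
    (forall v, out pa pb v = (v \notin B) :> nat).
Proof.
move=> /indep_card cK /parents[pa [pb [le_p out_p]]]; exists pa, pb; split=> // e.
have sumK : (\sum_e (e \in K : nat) = #|K|)%N by rewrite -big_mkcond sum1_card.

have le_sum : (\sum_e (pa e + pb e) <= \sum_e (e \in K : nat) ?= iff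
    [forall e, (pa e + pb e)%N == (e \in K)])%N.
  by apply: leqif_sum => e' _; apply/leqif_eq/le_p.
have : (\sum_e (pa e + pb e) == \sum_e (e \in K : nat))%N.
  rewrite eqn_leq le_sum sumK (leq_trans cK) // -sum_notin.
  by rewrite -(eq_bigr _ (fun v _ => out_p v)) sum_out.
by rewrite le_sum => /forallP/(_ e)/eqP.
Qed.

(** The inequality in Euler's formula.  The cycle space of [(U, A)] is the kernel of an
    incidence matrix whose rank is less than [#|U|], as the all-one vector is
    orthogonal to its rows; so it has dimension more than [#|A| - #|U|].  By assumption
    it lies in the row space of a matrix with one row for each face in [Phi]. *)
Lemma cycle_rank_bound (F : finType) (l r : E -> F) (A : {set E}) (U : {set V})
    (Phi : {set F}) u :
  u \in U -> (forall e, e \in A -> (a e \in U) && (b e \in U)) ->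
  (forall z, supported A z -> (forall v, bd z v = 0) ->
     exists2 psi : F -> 'F_2, forall f, f \notin Phi -> psi f = 0 &
       forall e, e \in A -> z e = psi (l e) + psi (r e)) ->
  (#|A| < #|U| + #|Phi|)%N.
Proof.
move=> uU AU cyc.
pose M : 'M['F_2]_(#|A|, #|U|) := \matrix_(i, j)
  ((a (enum_val i) == enum_val j)%:R + (b (enum_val i) == enum_val j)%:R).
pose D : 'M['F_2]_(#|Phi|, #|A|) := \matrix_(f, i)
  ((l (enum_val i) == enum_val f)%:R + (r (enum_val i) == enum_val f)%:R).
have sum_mem (T : finType) (X : {set T}) x (g : T -> 'F_2) : (x \notin X -> g x = 0) ->
    \sum_(j < #|X|) g (enum_val j) * (x == enum_val j)%:R = g x.
  move=> gx; rewrite -(big_enum_val (A := mem X) (fun y => g y * (x == y)%:R)) /=.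
  have [xX|xX] := boolP (x \in X); last first.
    rewrite gx // big1 // => y yX; case: eqP => [xy|_]; last by rewrite mulr0.
    by rewrite xy yX in xX.
  rewrite (bigD1 x) //= eqxx mulr1 big1 ?addr0 // => y /andP[_].
  by rewrite eq_sym => /negbTE ->; rewrite mulr0.
have MU : (\rank M < #|U|)%N.
  have M1 : M *m (const_mx 1 : 'cV_ _) = 0.
    apply/matrixP => i j; rewrite !mxE.
    under eq_bigr do rewrite !mxE mulr1.
    have /andP[aU bU] := AU _ (enum_valP i).
    rewrite big_split /=; have s x : x \in U -> \sum_(k < #|U|) (x == enum_val k)%:R = 1 :> 'F_2.
      move=> xU; rewrite -[RHS](sum_mem _ U x (fun=> 1)) ?xU //.
      by apply: eq_bigr => k _; rewrite mul1r.
    by rewrite !s // addF2.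
  have := mulmx0_rank_max M1.
  have -> : \rank (const_mx 1 : 'cV['F_2]_#|U|) = 1%N.
    apply/eqP; rewrite eqn_leq rank_leq_col lt0n mxrank_eq0.
    by apply/eqP => /matrixP/(_ (enum_rank_in uU u) 0); rewrite !mxE => /eqP; rewrite oner_eq0.
  by rewrite addn1.
have kerD : (kermx M <= D)%MS.
  apply/row_subP => i; set w := row i _.
  have wM : w *m M = 0 by rewrite /w -row_mul mulmx_ker row0.
  pose z e := \sum_(i < #|A|) w 0 i * (e == enum_val i)%:R.
  have zA : supported A z.
    move=> e eA; apply: big1 => j _; case: eqP => [ej|_]; last by rewrite mulr0.
    by rewrite ej enum_valP in eA.
  have zE j : z (enum_val j) = w 0 j.
    rewrite /z (bigD1 j) //= eqxx mulr1 big1 ?addr0 // => k kj.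
    by rewrite (inj_eq enum_val_inj) eq_sym (negbTE kj) mulr0.
  have sumA (g : E -> 'F_2) : \sum_e z e * g e = \sum_j w 0 j * g (enum_val j).
    rewrite (bigID (mem A)) /= [X in _ + X]big1 ?addr0; last by move=> e /zA ->; rewrite mul0r.
    rewrite (big_enum_val (A := mem A) (fun e => z e * g e)) /=.
    by apply: eq_bigr => j _; rewrite zE.
  have [|psi psi0 zpsi] := cyc z zA.
    move=> v; rewrite /bd sumA; have [vU|vU] := boolP (v \in U).
      have := congr1 (fun N : 'rV_ _ => N 0 (enum_rank_in vU v)) wM; rewrite !mxE => wM0.
      rewrite -[RHS]wM0.
      by apply: eq_bigr => j _; rewrite !mxE enum_rankK_in.
    apply: big1 => j _; have /andP[aU bU] := AU _ (enum_valP j).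
    have nv x : x \in U -> (x == v) = false by apply: contraTF => /eqP ->.
    by rewrite !nv // addr0 mulr0.
  apply/submxP; exists (\row_f psi (enum_val f)).
  apply/matrixP => ? j; rewrite !ord1 -zE zpsi ?enum_valP // mxE.
  under [RHS]eq_bigr do rewrite !mxE mulrDr.
  by rewrite big_split /= !sum_mem //; apply: psi0.
have := mxrankS kerD; rewrite mxrank_ker leq_subLR.
move=> /leq_ltn_trans; apply.
by rewrite -addSn leq_add // rank_leq_row.
Qed.

End Multigraph.

(** * Edmonds' description of the spanning tree polytope *)

Lemma sum_indicator (R : pzSemiRingType) (T : finType) (K A : {set T}) :
  \sum_(e in A) (e \in K)%:R = #|K :&: A|%:R :> R.
Proof.
rewrite -sum1_card natr_sum big_mkcond [RHS]big_mkcond.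
by apply: eq_bigr => e _; rewrite in_setI; do 2!case: (_ \in _).
Qed.

Section SpanningTreePolytope.
Variables (V E : finType) (a b : E -> V) (R : realFieldType).
Implicit Types (K A : {set E}) (S : {set V}) (x y : E -> R).

Definition inside S : {set E} := [set e | (a e \in S) && (b e \in S)].

(** With the equation [x(E) = |V| - 1], this describes the spanning tree polytope. *)
Definition forest_bounds x := (forall e, 0 <= x e) /\
  forall S u, u \in S -> \sum_(e in inside S) x e <= #|S|%:R - 1.

Lemma forest_inside K S u : indep a b set0 K -> u \in S ->
  (#|K :&: inside S| < #|S|)%N.
Proof.
move=> iK uS; rewrite -[ltnRHS]addn0 -(cards0 V).
apply: (cycle_rank_bound (a := a) (b := b) (l := a) (r := a) uS).
  by move=> e; rewrite !inE => /andP[].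
move=> z zK bz; exists (fun=> 0) => // e _; rewrite addr0.
by apply: iK => [e' e'K|v _]; [apply: zK; rewrite inE (negbTE e'K) | exact: bz].
Qed.

(** Adding up the bounds for the components of [K], each of size one less than the
    component, gives the number of vertices that are not the root of their component.
    Each of these has its own parent edge in [K]. *)
Lemma span_bound K A x : forest_bounds x ->
  (forall e, e \in A -> spans a b set0 K e) -> \sum_(e in A) x e <= #|K|%:R.
Proof.
move=> [x0 xS] spA; pose rt := fingraph.root (adj a b K).
pose B := [set v | rt v == v].
have csym := @adj_connect_sym V E a b K.
have rtK v : rt (rt v) = rt v := root_root csym v.
have toB v : exists2 u, u \in B & connect (adj a b K) v u.
  by exists (rt v); rewrite ?connect_root // inE rtK.
have cB : (#|~: B| <= #|K|)%N.
  have [pa [pb [le_p out_p]]] := parents toB.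
  rewrite -sum_notin -(eq_bigr _ (fun v _ => out_p v)) sum_out -sum1_card [leqRHS]big_mkcond.
  by apply: leq_sum => e _; have := le_p e; case: (e \in K).
apply: le_trans (_ : (#|~: B|)%:R <= _); last by rewrite ler_nat.
pose C u := [set v | rt v == u].
apply: (@le_trans _ _ (\sum_(u in B) \sum_(e in inside (C u)) x e)).
  rewrite (exchange_big_dep xpredT) //= [leLHS]big_mkcond.
  apply: ler_sum => e _; case: ifP => eA; last by apply: sumr_ge0 => *; exact: x0.
  have cab : connect (adj a b K) (a e) (b e).
    by case: (spA e eA) => [//|[[u]]]; rewrite inE.
  rewrite (bigD1 (rt (a e))) /= ?inE; last first.
    have -> : rt (b e) = rt (a e) by apply/esym/eqP; rewrite /rt root_connect.
  by rewrite rtK !eqxx.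
  by rewrite lerDl; apply: sumr_ge0 => *; exact: x0.
apply: (@le_trans _ _ (\sum_(u in B) (#|C u|%:R - 1))).
  by apply: ler_sum => u; rewrite inE => uB; apply: (xS _ u); rewrite inE.
have -> : #|~: B| = (#|V| - #|B|)%N by rewrite -(cardsC B) addKn.
rewrite natrB ?max_card // sumrB -natr_sum sumr_const lerD2r ler_nat.
rewrite -[leqRHS]sum1_card [leqRHS](partition_big rt (mem B)) /=; last first.
  by move=> v _; rewrite inE rtK.
by apply: leq_sum => u _; rewrite sum1dep_card cardsE.
Qed.

(** Kruskal's algorithm: a forest which is maximal in each of the nested sets [A 0],
    [A 1], and so on, has at least as much of each of them as [x]. *)
Lemma kruskal x (A : nat -> {set E}) n : forest_bounds x ->
  (forall j, A j \subset A j.+1) ->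
  exists K, [/\ K \subset A n, indep a b set0 K,
    forall e, e \in A n -> spans a b set0 K e &
    forall j, (j <= n)%N -> \sum_(e in A j) x e <= #|K :&: A j|%:R].
Proof.
move=> bx monA; elim: n => [|n [K0 [K0A iK0 spK0 leK0]]].
  have [K [_ KA iK sp]] := extend_indep (sub0set (A 0%N)) (@indep0 V E a b set0).
  by exists K; split=> // j; rewrite leqn0 => /eqP ->; rewrite (setIidPl KA) span_bound.
have [K [K0K KA iK sp]] := extend_indep (subset_trans K0A (monA n)) iK0.
exists K; split=> // j; rewrite leq_eqVlt => /orP[/eqP ->|jn].
  by rewrite (setIidPl KA) span_bound.
by apply: le_trans (leK0 _ jn) _; rewrite ler_nat subset_leq_card // setSI.
Qed.

(** A spanning tree in the smallest face of the polytope that contains [x].  Give an edge the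
    weight [c e], the number of tight constraints that reward its use.  Among all points
    of the polytope, those of this face are the ones of maximal weight, and so a
    maximum weight spanning tree, as found by Kruskal's algorithm, lies in it. *)
Lemma minimal_face_tree x (v0 : V) : forest_bounds x -> \sum_e x e = #|V|.-1%:R ->
  (forall u v, connect (adj a b [set: E]) u v) ->
  exists K, [/\ indep a b set0 K, forall u v, connect (adj a b K) u v,
    forall e, x e = 0 -> e \notin K,
    forall S u, u \in S -> \sum_(e in inside S) x e = #|S|%:R - 1 ->
      #|K :&: inside S| = #|S|.-1 & #|K| = #|V|.-1].
Proof.
move=> bx sumx conn.
pose tight S := (S != set0) && (\sum_(e in inside S) x e == #|S|%:R - 1).
(* The second term stands for the constraint [x e >= 0], with the weights shifted by one
   to make them natural numbers; this is harmless, since all points have the same sum. *)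
pose c e := (#|[set S | tight S & e \in inside S]| + (x e != 0%R))%N.
pose M := (#|{set V}| + 1)%N.
have cM e : (c e <= M)%N by rewrite leq_add ?max_card // leq_b1.
(* The level sets of [c]: a weighted sum is the sum of the sums over them. *)
pose A j := [set e | (M <= c e + j)%N].
have monA j : A j \subset A j.+1.
  by apply/subsetP => e; rewrite !inE addnS => /leqW.
have [K [KA iK sp leK]] := kruskal M bx monA.
have AM : A M = [set: E] by apply/setP => e; rewrite !inE leq_addl.
rewrite AM in sp.
have cK u v : connect (adj a b K) u v by apply: (spans_connect0 sp); apply: conn.
have V0 : (0 < #|V|)%N by apply/card_gt0P; exists v0.
have layer y : \sum_e (c e)%:R * y e = \sum_(j < M) \sum_(e in A j) y e.
  under [RHS]eq_bigr do rewrite big_mkcond.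
  rewrite exchange_big /=; apply: eq_bigr => e _.
  rewrite -big_mkcond /= sumr_const mulr_natl; congr (_ *+ _).
  transitivity (#|[set i : 'I_M | (M - c e <= i)%N]|); last first.
    by rewrite cardsE; apply: eq_card => i; rewrite -[RHS]/(e \in A i) inE -[LHS]/(M - c e <= i)%N leq_subLR.
  have := cardsC [set i : 'I_M | (i < M - c e)%N]; rewrite card_ord.
  have -> : #|[set i : 'I_M | (i < M - c e)%N]| = (M - c e)%N.
    have le : (M - c e <= M)%N by apply: leq_subr.
    by rewrite -sum1dep_card -(big_ord_widen M (fun=> 1%N) le) sum_nat_const card_ord muln1.
  have -> : ~: [set i : 'I_M | (i < M - c e)%N] = [set i : 'I_M | (M - c e <= i)%N].
    by apply/setP => i; rewrite !inE -leqNgt.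
  have := cM e; lia.
have split_c y : \sum_e (c e)%:R * y e =
    \sum_(S | tight S) \sum_(e in inside S) y e + \sum_(e | x e != 0) y e.
  under [LHS]eq_bigr do rewrite natrD mulrDl.
  rewrite big_split /=; congr (_ + _); last first.
    by rewrite [RHS]big_mkcond; apply: eq_bigr => e _; case: (x e != 0); rewrite ?mul1r ?mul0r.
  under [RHS]eq_bigr do rewrite big_mkcond.
  rewrite exchange_big /=; apply: eq_bigr => e _.
  rewrite -big_mkcondr /= sumr_const mulr_natl; congr (_ *+ _).
  by apply: eq_card => S; rewrite inE -[RHS]/(tight S && (e \in inside S)).
have cardK : (#|K| <= #|V|.-1)%N.
  have := forest_inside iK (in_setT v0).
  rewrite cardsT (setIidPl _); first by lia.
  by apply/subsetP => e; rewrite !inE.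
have: \sum_e (c e)%:R * x e <= \sum_e (c e)%:R * (e \in K)%:R.
  rewrite !layer; apply: ler_sum => j _; apply: le_trans (leK _ (ltnW (ltn_ord j))) _.
  by rewrite sum_indicator.
have -> : \sum_e (c e)%:R * x e = (\sum_(S | tight S) #|S|.-1 + #|V|.-1)%:R.
  rewrite split_c natrD natr_sum -sumx; congr (_ + _).
    apply: eq_bigr => S /andP[/set0Pn[u uS] /eqP ->].
    by rewrite -subn1 natrB // card_gt0; apply/set0Pn; exists u.
  by rewrite big_mkcond; apply: eq_bigr => e _; case: eqP => [->|].
have -> : \sum_e (c e)%:R * (e \in K)%:R =
    (\sum_(S | tight S) #|K :&: inside S| + #|K :&: [set e | x e != 0%R]|)%:R :> R.
  rewrite split_c natrD natr_sum; congr (_ + _).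
    by apply: eq_bigr => S _; rewrite sum_indicator.
  by rewrite -sum_indicator; apply: eq_bigl => e; rewrite inE.
rewrite ler_nat => le_all.
have leS : (\sum_(S | tight S) #|K :&: inside S| <= \sum_(S | tight S) #|S|.-1 ?=
     iff [forall (S | tight S), #|K :&: inside S| == #|S|.-1])%N.
  apply: leqif_sum => S /andP[/set0Pn[u uS] _]; apply: leqif_eq.
  by have := forest_inside iK uS; lia.
have KsK : (#|K :&: [set e | x e != 0%R]| <= #|K|)%N by rewrite subset_leq_card // subsetIl.
have eqS : (\sum_(S | tight S) #|K :&: inside S| == \sum_(S | tight S) #|S|.-1)%N.
  by rewrite eqn_leq leS; move: le_all KsK cardK; lia.
have eK : #|K :&: [set e | x e != 0%R]| = #|K|.
  by apply/eqP; rewrite eqn_leq KsK; move: (eqP eqS) le_all cardK => ->; lia.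
exists K; split=> //.
- move=> e xe; apply/negP => eK'.
  have : K :&: [set e | x e != 0%R] == K by rewrite eqEcard subsetIl eK leqnn.
  by move=> /eqP/setP/(_ e); rewrite !inE eK' xe eqxx.
- move=> S u uS xS; move: eqS; rewrite leS => /forall_inP/(_ S) h; apply/eqP/h.
  by rewrite /tight xS eqxx andbT; apply/set0Pn; exists u.
- by apply/eqP; rewrite eqn_leq cardK; move: (eqP eqS) le_all eK => ->; lia.
Qed.

(** Move from [x] away from a tree in the smallest face of [x], until a further constraint
    becomes tight at a point [y].  By induction on the number of constraints that are
    not tight, [y] is a convex combination of trees, and [x] lies between [y] and the tree. *)
Theorem spanning_tree_polytope (C : (E -> R) -> Prop) x :
  (forall u v, connect (adj a b [set: E]) u v) ->
  forest_bounds x -> \sum_e x e = #|V|.-1%:R ->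
  (forall y z t, 0 <= t <= 1 -> C y -> C z -> C (fun e => t * y e + (1 - t) * z e)) ->
  (forall K, indep a b set0 K -> (forall u v, connect (adj a b K) u v) ->
     C (fun e => (e \in K)%:R)) ->
  C x.
Proof.
move=> conn bx sumx convC treeC.
have [v0|noV] := pickP (@predT V); last first.
  have noE (e : E) : False by have := noV (a e).
  have -> : x = (fun e => (e \in set0)%:R) by apply/funext => e; case: (noE e).
  by apply: treeC => [|u v]; [exact: indep0 | have := noV u].
move=> _.
pose s (i : E + {set V}) y := match i with
  | inl e => y e
  | inr U => if U == set0 then 0 else #|U|%:R - 1 - \sum_(e in inside U) y e end.
have s_aff i y z t : s i (fun e => y e + t * (y e - z e)) = s i y + t * (s i y - s i z).
  case: i => [e //|S] /=; case: ifP => _; first by ring.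
  by rewrite big_split /= -mulr_sumr sumrB; ring.
have s_bounds y : (forall i, 0 <= s i y) <-> forest_bounds y.
  split=> [sy|[y0 yS] [e|S]] /=.
  - split=> [e|S u uS]; first exact: (sy (inl e)).
    have := sy (inr S); rewrite /= ifF ?subr_ge0 //.
    by apply/negP => /eqP S0; rewrite S0 inE in uS.
  - exact: y0.
  - by case: eqP => // /eqP/set0Pn[u uS]; rewrite subr_ge0 (yS _ u).
have [n] := ubnP #|[set i | s i x != 0]|; elim: n x bx sumx => // n IH x bx sumx ltn.
have [K [iK cK K0 KS cardK]] := minimal_face_tree v0 bx sumx conn.
pose T e : R := (e \in K)%:R.
have CT : C T by apply: treeC.
have [->//|neT] := eqVneq x T.
have sumT : \sum_e T e = #|V|.-1%:R.
  by rewrite -cardK -(setIT K) -sum_indicator; apply: eq_bigl => e; rewrite inE.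
have sT0 i : s i x = 0 -> s i T = 0.
  case: i => [e /= /K0/negbTE|S] /=; first by rewrite /T => ->.
  case: eqP => // /eqP/set0Pn[u uS] /eqP; rewrite subr_eq0 => /eqP/esym/(KS _ _ uS) cS.
  have S0 : (0 < #|S|)%N by apply/card_gt0P; exists u.
  by rewrite sum_indicator cS -subn1 natrB // subrr.
have sx0 := (s_bounds x).2 bx.
have [i0 i0P] : exists i, s i x < s i T.
  apply/not_existsP => no; move/eqP: neT; apply; apply: funext => e.
  have le e' : T e' <= x e' by rewrite leNgt; apply/negP/(no (inl e')).
  have : \sum_e' (x e' - T e') = 0 by rewrite sumrB sumx sumT subrr.
  move/eqP; rewrite psumr_eq0 => [/allP/(_ e)|e' _]; last by rewrite subr_ge0.
  by rewrite mem_index_enum subr_eq0 => /(_ isT)/eqP.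
pose ratio i := s i x / (s i T - s i x).
have [i1 /= i1P minr] := @Order.TotalTheory.arg_minP _ R _ i0 (fun i => s i x < s i T) ratio i0P.
(* The largest step for which no constraint is violated; [i1] becomes tight. *)
pose t := ratio i1.
have si1 : 0 < s i1 x.
  by rewrite lt_def sx0 andbT; apply/eqP => e0; move: i1P; rewrite e0 sT0 ?ltxx.
have t0 : 0 < t by rewrite divr_gt0 // subr_gt0.
pose y e := x e + t * (x e - T e).
have sy0 i : 0 <= s i y.
  rewrite s_aff; have [lt|ge] := ltP (s i x) (s i T); last first.
    by apply: addr_ge0 => //; apply: mulr_ge0; rewrite ?subr_ge0 // ltW.
  have := minr i lt; rewrite -/t /ratio ler_pdivlMr ?subr_gt0 //; lra.
have Cy : C y.
  apply: IH; first exact/s_bounds.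
    by rewrite big_split /= -mulr_sumr sumrB sumx sumT subrr mulr0 addr0.
  rewrite -ltnS (leq_trans _ ltn) // ltnS proper_card //; apply/properP; split.
    apply/subsetP => i; rewrite !inE; apply: contra => /eqP e0.
    by rewrite s_aff e0 sT0 // subrr mulr0 addr0.
  exists i1; first by rewrite inE gt_eqF.
  rewrite inE negbK s_aff /t /ratio.
  have ne : s i1 T - s i1 x != 0 by rewrite gt_eqF // subr_gt0.
  by apply/eqP; field.
have -> : x = fun e => (1 + t)^-1 * y e + (1 - (1 + t)^-1) * T e.
  apply/funext => e; rewrite /y; field; lra.
apply: convC => //; rewrite invr_ge0 invf_le1; lra.
Qed.

End SpanningTreePolytope.

(** * Plane duals: soundness and completeness of the formulation, edge bound *)

Lemma sum_out_in (V E : finType) (a b : E -> V) (M : nmodType) (pa pb : E -> M) (S : {set V}) :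
  \sum_(v in S) out a b pa pb v =
  \sum_e ((if a e \in S then pa e else 0) + (if b e \in S then pb e else 0)).
Proof.
rewrite !big_split /= -!big_mkcond /=; congr (_ + _).
  rewrite [RHS](partition_big a (mem S)) //=; apply: eq_bigr => v vS.
  by apply: eq_bigl => e; case: eqP => [->|]; rewrite ?vS ?andbF.
rewrite [RHS](partition_big b (mem S)) //=; apply: eq_bigr => v vS.
by apply: eq_bigl => e; case: eqP => [->|]; rewrite ?vS ?andbF.
Qed.

Lemma sum_neq (R : realFieldType) (T : finType) (X : {set T}) (t : T) : t \notin X ->
  \sum_(v in X) (v != t)%:R = #|X|%:R :> R.
Proof.
move=> tX; rewrite -sum1_card natr_sum; apply: eq_bigr => v vX.
by have -> : v != t by apply: contraNneq tX => <-.
Qed.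

(** The edges inside [S] are among those paid for by the vertices of [S], and the root
    pays nothing. *)
Lemma rooted_bound (V E : finType) (a b : E -> V) (R : realFieldType) (pa pb : E -> R)
    (rt : V) (S : {set V}) :
  (forall e, 0 <= pa e) -> (forall e, 0 <= pb e) ->
  (forall v, out a b pa pb v = (v != rt)%:R) -> rt \in S ->
  \sum_(e in inside a b S) (pa e + pb e) <= #|S|%:R - 1.
Proof.
move=> pa0 pb0 outp rS.
apply: (@le_trans _ _ (\sum_(v in S) out a b pa pb v)).
  rewrite sum_out_in big_mkcond /=; apply: ler_sum => e _; rewrite inE.
  by case: (a e \in S); case: (b e \in S); rewrite //= ?addr0 ?add0r // addr_ge0.
under eq_bigr do rewrite outp.
rewrite (bigD1 rt) //= eqxx add0r (cardsD1 rt S) rS natrD [X in _ <= X - _]addrC addrK.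
rewrite -(@sum_neq _ _ (S :\ rt) rt) ?setD11 // le_eqVlt; apply/orP; left; apply/eqP.
by apply: eq_bigl => v; rewrite !inE andbC.
Qed.

Section PlaneDual.
Variables (V E F : finType) (a b : E -> V) (l r : E -> F).

Definition at_vertex v e := (a e == v) || (b e == v).

(** Those edges that separate a face with value one from a face with value zero: the boundary
    of the set of faces [psi]. *)
Definition coboundary (psi : F -> 'F_2) e := psi (l e) + psi (r e).

(** What the proof needs to know of a plane graph, where [l e] and [r e] are the faces on both
    sides of the edge [e].  The last property says that one can walk around [v] from any
    face at [v] to any other, crossing only edges at [v]. *)
Record plane_dual : Prop := PlaneDual {
  dual_bd : forall psi v, bd a b (coboundary psi) v = 0;
  dual_cycle : forall z, (forall v, bd a b z v = 0) ->
    exists psi, forall e, z e = coboundary psi e;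
  dual_connected : forall psi, (forall e, psi (l e) = psi (r e) :> 'F_2) ->
    forall f f', psi f = psi f';
  dual_star : forall psi v,
    (forall e, at_vertex v e -> psi (l e) = psi (r e) :> 'F_2) ->
    forall e e', at_vertex v e -> at_vertex v e' -> psi (l e) = psi (l e')
}.

Hypothesis dual : plane_dual.

Section Williams.
Variables (R : realFieldType) (rt : V) (f0 : F).

Hypothesis incident_roots : forall v, v != rt -> exists2 e, at_vertex rt e & l e = f0.

(** If the root [rt] is in [S], the primal outflows suffice.  Otherwise, let [Phi] be the faces
    that can be reached from the root face [f0] without crossing an edge inside [S], and let
    [EA] be the edges inside [S] and those with a side outside [Phi].  A vertex outside [S]
    has either all or none of its edges in [EA], and [rt] has none, as it touches [f0].
    The capacity [#|EA|] pays for the primal arcs inside [S], for the vertices outside [S]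
    touched by [EA] and for the faces outside [Phi]; by Euler's inequality for [EA], at
    most [#|S| - 1] is left for the arcs inside [S]. *)
Lemma williams_sound (pa pb dl dr : E -> R) (S : {set V}) u :
  (forall e, [/\ 0 <= pa e, 0 <= pb e, 0 <= dl e & 0 <= dr e]) ->
  (forall e, pa e + pb e + (dl e + dr e) <= 1) ->
  (forall v, out a b pa pb v = (v != rt)%:R) ->
  (forall f, out l r dl dr f = (f != f0)%:R) ->
  u \in S -> \sum_(e in inside a b S) (pa e + pb e) <= #|S|%:R - 1.
Proof.
move=> ge0 cap outp outd uS.
have [rS|rS] := boolP (rt \in S).
  by apply: (rooted_bound (rt := rt)) => // e; have [] := ge0 e.
have [|e0 e0rt le0] := incident_roots (v := u); first by apply: contraTneq uS => ->.
pose Phi := [set f | connect (adj l r (~: inside a b S)) f0 f].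
pose EA := [set e | (e \in inside a b S) || (l e \notin Phi) || (r e \notin Phi)].
pose VA := S :|: [set v | [exists e in EA, at_vertex v e]].
have PhiE e : e \notin inside a b S -> (l e \in Phi) = (r e \in Phi).
  move=> eS; rewrite !inE; apply: same_connect_r; first exact: adj_connect_sym.
  by apply/connect1/adj_edge; rewrite inE.
have f0Phi : f0 \in Phi by rewrite inE.
pose psi f : 'F_2 := (f \in Phi)%:R.
have psi_inj f f' : psi f = psi f' -> (f \in Phi) = (f' \in Phi).
  by rewrite /psi; do 2!case: (_ \in Phi).
have star v e e' : v \notin S -> at_vertex v e -> at_vertex v e' ->
    (e \in EA) = (e' \in EA).
  move=> vS ve ve'.
  have out_in e1 : at_vertex v e1 -> e1 \notin inside a b S.
    by rewrite inE => /orP[]/eqP ->; rewrite (negbTE vS) ?andbF.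
  have := dual_star dual (psi := psi) (v := v) _ ve ve'.
  move/(_ (fun e1 ve1 => congr1 (fun c : bool => c%:R) (PhiE e1 (out_in e1 ve1))))/psi_inj.
  rewrite !inE -!in_set -/Phi.
  have := out_in _ ve; have := out_in _ ve'; rewrite !inE => /negbTE-> /negbTE->.
  have := PhiE _ (out_in _ ve); have := PhiE _ (out_in _ ve').
  by rewrite !inE => <- <- ->.
have VAS v e : v \in VA :\: S -> at_vertex v e -> e \in EA.
  case/setDP; rewrite in_setU => /orP[->//|]; rewrite in_set => /exists_inP[e' e'A ve'] vS ve.
  by rewrite -(star _ _ _ vS ve' ve).
have rVA : rt \notin VA :\: S.
  apply/negP => /VAS/(_ e0rt); rewrite inE le0 f0Phi /=.
  have e0S : e0 \notin inside a b S.
    by rewrite inE; case/orP: e0rt => /eqP ->; rewrite (negbTE rS) ?andbF.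
  by rewrite (negbTE e0S) -PhiE // le0 f0Phi.
have rank : (#|EA| < #|VA| + #|~: Phi|)%N.
  apply: (cycle_rank_bound (a := a) (b := b) (l := l) (r := r) (u := u)).
  - by rewrite inE uS.
  - move=> e eA; rewrite !inE; apply/andP; split; apply/orP; right;
      by apply/exists_inP; exists e; rewrite // /at_vertex eqxx ?orbT.
  move=> z zA /(dual_cycle dual)[psi1 zpsi1].
  exists (fun f => psi1 f + psi1 f0); last first.
    by move=> e _; rewrite addrACA addF2 addr0 zpsi1.
  move=> f; rewrite inE negbK inE.
  (* A cycle on [EA] crosses no edge by which a face of [Phi] is reached, so [psi1] is
     constant on [Phi]; adding the constant makes it vanish there. *)
  pose C := [set f | (f \in Phi) && (psi1 f == psi1 f0)].
  move/(closed_connect (C := C)); rewrite !inE connect0 eqxx /=.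
  move=> h; apply/eqP; rewrite addF2_eq0.
  suff /h/esym/andP[] : forall e, e \in ~: inside a b S -> (l e \in C) = (r e \in C) by [].
  move=> e; rewrite inE => eS; rewrite inE (PhiE _ eS) [RHS]inE.
  have [rPhi /=|//] := boolP (r e \in Phi).
  suff -> : psi1 (l e) = psi1 (r e) by [].
  apply/eqP; rewrite -addF2_eq0 -/(coboundary _ _) -zpsi1 zA //.
  by rewrite inE negb_or (negbTE eS) PhiE // rPhi.
have main : \sum_(e in inside a b S) (pa e + pb e) +
    \sum_(v in VA :\: S) out a b pa pb v + \sum_(f in ~: Phi) out l r dl dr f <=
    \sum_(e in EA) 1.
  rewrite !sum_out_in [X in X + _ + _]big_mkcond [leRHS]big_mkcond -!big_split /=.
  apply: ler_sum => e _; have [pa0 pb0 dl0 dr0] := ge0 e.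
  have cp := cap e.
  have le_if (c : bool) (t : R) : 0 <= t -> (if c then t else 0) <= t by case: c.
  have [eS|eS] := boolP (e \in inside a b S).
    have eA : e \in EA by rewrite inE eS.
    move: eS; rewrite inE eA => /andP[aS bS]; rewrite !inE aS bS /= !addr0.
    by apply: le_trans cp; rewrite lerD2l lerD // le_if.
  rewrite add0r; have [eA|eA] := boolP (e \in EA).
    by apply: le_trans cp; rewrite !lerD // le_if.
  have -> : (a e \in VA :\: S) = false.
    by apply: contraNF eA => /VAS; apply; rewrite /at_vertex eqxx.
  have -> : (b e \in VA :\: S) = false.
    by apply: contraNF eA => /VAS; apply; rewrite /at_vertex eqxx orbT.
  move: eA; rewrite inE !negb_or !negbK => /andP[/andP[_ lP] rP].
  by rewrite ![_ \in ~: Phi]inE lP rP /= !addr0.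
have sV : \sum_(v in VA :\: S) out a b pa pb v = #|VA|%:R - #|S|%:R.
  under eq_bigr do rewrite outp.
  rewrite sum_neq // cardsD (setIidPr _) ?subsetUl // natrB //.
  by rewrite subset_leq_card // subsetUl.
have sF : \sum_(f in ~: Phi) out l r dl dr f = #|~: Phi|%:R.
  under eq_bigr do rewrite outd.
  by rewrite sum_neq // inE f0Phi.
move: main; rewrite sV sF sumr_const => main.
have : (#|EA|%:R + 1 : R) <= #|VA|%:R + #|~: Phi|%:R by rewrite natr1 -natrD ler_nat.
by lra.
Qed.

(** Extend the forest to a spanning tree [T].  The set of faces that can be reached from a given
    one by crossing edges outside [T] has its boundary in [T]; but a boundary is a cycle, so
    it vanishes, and all faces are reached.  Thus the dual arcs fit into the edges outside [T]. *)
Lemma williams_complete K0 : indep a b set0 K0 ->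
  (forall u v, connect (adj a b [set: E]) u v) ->
  exists pa pb dl dr : E -> nat,
    [/\ forall e, ((e \in K0) <= pa e + pb e)%N,
        forall e, (pa e + pb e + (dl e + dr e) <= 1)%N,
        forall v, out a b pa pb v = (v != rt) :> nat &
        forall f, out l r dl dr f = (f != f0) :> nat].
Proof.
move=> iK0 conn.
have [T [K0T _ iT sp]] := extend_indep (subsetT K0) (indep_root (r := rt) iK0).
have toR v : exists2 u, u \in [set rt] & connect (adj a b T) v u.
  by apply: (spans_connect sp (u := rt)); rewrite ?inE.
have [pa [pb [pT outp]]] := tree_parents iT toR.
have toF f : exists2 g, g \in [set f0] & connect (adj l r (~: T)) f g.
  exists f0; rewrite ?inE //.
  pose psi g : 'F_2 := (connect (adj l r (~: T)) f g)%:R.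
  have cT e : psi (l e) = psi (r e).
    have [eT|eT] := boolP (e \in T); last first.
      congr (_ : bool)%:R; apply: same_connect_r; first exact: adj_connect_sym.
      by apply/connect1/adj_edge; rewrite inE.
    apply/eqP; rewrite -addF2_eq0; apply/eqP.
    apply: (iT (coboundary psi)) => [e' e'T|v _]; last exact: dual_bd.
    apply/eqP; rewrite addF2_eq0; apply/eqP.
    congr (_ : bool)%:R; apply: same_connect_r; first exact: adj_connect_sym.
    by apply/connect1/adj_edge; rewrite inE.
  have := dual_connected dual cT f f0; rewrite /psi connect0.
  by case: (connect _ _ _).
have [dl [dr [dT outd]]] := parents toF.
exists pa, pb, dl, dr; split=> [e|e|v|f].
- by rewrite pT; have := subsetP K0T e; do 2!case: (_ \in _) => // /(_ isT).
- by rewrite pT; have := dT e; rewrite inE; case: (e \in T) => //=; rewrite leqn0 => /eqP ->.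
- by rewrite outp inE.
- by rewrite outd inE.
Qed.

End Williams.

Hypothesis loopless : forall e, a e != b e.
Hypothesis simple : forall e e', [set a e; b e] = [set a e'; b e'] -> e = e'.

(** At each end of an edge a cycle continues with another edge, and in a simple graph these
    two are different. *)
Lemma cycle_size z e : (forall v, bd a b z v = 0) -> z e != 0 ->
  (2 < #|[set e' | z e' != 0%R]|)%N.
Proof.
move=> bz ze.
have other v : at_vertex v e -> exists e', [/\ e' != e, z e' != 0 & at_vertex v e'].
  move=> ve; apply/not_existsP => no; have := bz v; rewrite /bd (bigD1 e) //= big1 => [|e' e'e].
    rewrite addr0 (F2_neq0 ze) mul1r F2_natr_addb.
    suff -> : (a e == v) (+) (b e == v) by [].
    by case/orP: ve => /eqP <-; rewrite eqxx ?(negbTE (loopless e)) // eq_sym (negbTE (loopless e)).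
  have [->|ze'] := eqVneq (z e') 0; first by rewrite mul0r.
  have : ~~ at_vertex v e' by apply/negP => ve'; apply: (no e').
  by rewrite negb_or => /andP[/negbTE -> /negbTE ->]; rewrite addr0 mulr0.
have [|e1 [e1e ze1 ae1]] := other (a e); first by rewrite /at_vertex eqxx.
have [|e2 [e2e ze2 be2]] := other (b e); first by rewrite /at_vertex eqxx orbT.
have e12 : e1 != e2.
  apply/eqP => e12; move: be2; rewrite -e12 => be1; case/eqP: e1e; apply: simple.
  move: (loopless e); case/orP: ae1 => /eqP <-; case/orP: be1 => /eqP <- //.
    by rewrite eqxx.
  - by move=> _; rewrite setUC.
  - by rewrite eqxx.
apply: leq_trans (_ : #|[set e; e1; e2]| <= _)%N.
  by rewrite setUC cardsU1 cards2 !inE negb_or e2e eq_sym e12 eq_sym e1e.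
by apply/subset_leq_card/subsetP => e'; rewrite !inE => /orP[/orP[]|] /eqP ->.
Qed.

(** Euler's inequality together with the fact that each face with nonzero boundary has at least
    three edges, while an edge has two sides.  Faces with zero boundary do not contribute to
    the span of the boundaries. *)
Lemma planar_edge_bound (v0 : V) : (#|E| <= 3 * #|V|.-1)%N.
Proof.
pose delta f : {set E} := [set e | (l e == f) (+) (r e == f)].
pose F' := [set f | delta f != set0].
have V0 : (0 < #|V|)%N by apply/card_gt0P; exists v0.
have rank : (#|[set: E]| < #|[set: V]| + #|F'|)%N.
  apply: (cycle_rank_bound (a := a) (b := b) (l := l) (r := r) (u := v0)) => // [e|z _].
    by rewrite !inE.
  move=> /(dual_cycle dual)[psi zpsi]; exists (fun f => if f \in F' then psi f else 0).
    by move=> f /negbTE ->.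
  move=> e _; rewrite zpsi /coboundary.
  have [->|lr] := eqVneq (l e) (r e); first by rewrite !addF2.
  have -> : l e \in F'.
    by rewrite inE; apply/set0Pn; exists e; rewrite inE eqxx eq_sym (negbTE lr).
  suff -> : r e \in F' by [].
  by rewrite inE; apply/set0Pn; exists e; rewrite inE eqxx (negbTE lr).
have large f : f \in F' -> (3 <= #|delta f|)%N.
  rewrite inE => /set0Pn[e]; rewrite inE => fe.
  pose psi g : 'F_2 := (g == f)%:R.
  have deltaE e' : coboundary psi e' = ((l e' == f) (+) (r e' == f))%:R.
    exact: F2_natr_addb.
  have := cycle_size (z := coboundary psi) (e := e) (dual_bd dual psi).
  rewrite deltaE fe => /(_ isT); congr (_ < _)%N; apply: eq_card => e'.
  by rewrite !inE deltaE; case: (_ (+) _).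
have : (3 * #|F'| <= 2 * #|E|)%N.
  rewrite mulnC -sum_nat_const; apply: leq_trans (_ : \sum_(f in F') #|delta f| <= _)%N.
    exact: leq_sum.
  rewrite mulnC -cardsT -sum_nat_const; under eq_bigr do rewrite -sum1_card big_mkcond.
  rewrite exchange_big /= [leqRHS]big_mkcond; apply: leq_sum => e _; rewrite inE.
  rewrite -big_mkcondr /= sum1_card; apply: leq_trans (_ : #|[set l e; r e]| <= _)%N; last first.
    by rewrite cards2; case: (_ != _).
  apply/subset_leq_card/subsetP => f; rewrite -[f \in _]/((f \in F') && (e \in delta f)).
  by rewrite !inE ![_ == f]eq_sym => /andP[_]; do 2!case: (f == _).
move: rank; rewrite !cardsT; lia.
Qed.

End PlaneDual.

(** * Plane duals of minors *)

Section Minor.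
Variables (V E F : finType) (a b : E -> V) (l r : E -> F) (I : {set E}).
Hypothesis big_bd : forall psi v, bd a b (coboundary l r psi) v = 0.
Hypothesis big_cycle : forall z, supported I z -> (forall v, bd a b z v = 0) ->
  exists psi, forall e, z e = coboundary l r psi e.
Hypothesis big_connected : forall psi, (forall e, psi (l e) = psi (r e) :> 'F_2) ->
  forall f f', psi f = psi f'.
Hypothesis big_star : forall psi v,
  (forall e, at_vertex a b v e -> psi (l e) = psi (r e) :> 'F_2) ->
  forall e e', at_vertex a b v e -> at_vertex a b v e' -> psi (l e) = psi (l e').

Variables (U : finType) (c : U -> V) (K : {set E}).
Hypothesis c_inj : injective c.
Hypothesis KI : K \subset I.
Hypothesis K_indep : indep a b (c @: U) K.
Hypothesis I_base : forall e, e \in I ->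
  (exists u, connect (adj a b K) (c u) (a e)) /\
  (exists u, connect (adj a b K) (c u) (b e)).
Hypothesis I_connected : forall u v, connect (adj a b I) (c u) (c v).

Let part u := [set x | connect (adj a b K) (c u) x].

(** A path in [K] between two base points would be a chain with boundary in the bases. *)
Lemma part_uniq u v x : x \in part u -> x \in part v -> u = v.
Proof.
rewrite !inE => ux; rewrite adj_connect_sym => xv.
have [z zK bz] := connect_chain (connect_trans ux xv).
have z0 : forall e, z e = 0.
  apply: K_indep zK _ => w wB; rewrite bz.
  have cw t : (c t == w) = false.
    by apply: contraNF wB => /eqP <-; apply: imset_f.
  by rewrite !cw addr0.
have := bz (c u); rewrite /bd big1 => [|e _]; last by rewrite z0 mul0r.
rewrite eqxx (inj_eq c_inj) => /esym/eqP; rewrite F2_natr_addb.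
by have [->|] := eqVneq v u.
Qed.

Lemma part_edge u e : e \in K -> (a e \in part u) = (b e \in part u).
Proof.
move=> eK; rewrite !inE; apply: same_connect_r; first exact: adj_connect_sym.
exact/connect1/adj_edge.
Qed.

(** With [u] and [v] in either order; [linked] orders them, to have one edge per pair. *)
Let link e u v := ((a e \in part u) && (b e \in part v)) ||
  ((a e \in part v) && (b e \in part u)).

Let linked (p : U * U) := (enum_rank p.1 < enum_rank p.2)%N &&
  [exists e in I, link e p.1 p.2].

Let E' := {p : U * U | linked p}.
Let a' (p : E') := (val p).1.
Let b' (p : E') := (val p).2.

Let a'_neq (p : E') : a' p != b' p.
Proof.
by have /andP[lt _] := valP p; apply: contraTneq lt; rewrite /a' /b' => ->; rewrite ltnn.
Qed.

Lemma link_ex (p : E') : exists e, (e \in I) && link e (a' p) (b' p).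
Proof. by have /andP[_ /exists_inP[e eI le]] := valP p; exists e; rewrite eI. Qed.

Let g p := xchoose (link_ex p).

Lemma gI p : g p \in I.
Proof. by have /andP[] := xchooseP (link_ex p). Qed.

Lemma g_link p : link (g p) (a' p) (b' p).
Proof. by have /andP[] := xchooseP (link_ex p). Qed.

Lemma g_part p u : ((a (g p) \in part u)%:R + (b (g p) \in part u)%:R : 'F_2) =
  (a' p == u)%:R + (b' p == u)%:R.
Proof.
have inP x w : x \in part w -> (x \in part u) = (w == u).
  move=> xw; apply/idP/eqP => [xu|<- //]; exact: part_uniq xw xu.
case/orP: (g_link p) => /andP[/inP -> /inP ->] //; exact: addrC.
Qed.

Lemma g_notK p : g p \notin K.
Proof.
apply/negP => gK; have := g_part p (a' p); rewrite (part_edge _ gK) addF2.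
by rewrite eqxx eq_sym (negbTE (a'_neq p)) addr0 => /eqP; rewrite eq_sym oner_eq0.
Qed.

Let simple' p q : [set a' p; b' p] = [set a' q; b' q] -> p = q.
Proof.
move=> /setP eqpq; apply/val_inj; have /andP[ltp _] := valP p; have /andP[ltq _] := valP q.
have := eqpq (a' p); have := eqpq (b' p); rewrite !inE !eqxx orbT /=.
case: p q {eqpq} ltp ltq => -[p1 p2] /= hp [[q1 q2] /= hq]; rewrite /a' /b' /=.
move=> ltp ltq /esym/orP[]/eqP e2 /esym/orP[]/eqP e1; subst => //.
- by rewrite ltnn in ltp.
- by have := ltn_trans ltp ltq; rewrite ltnn.
- by rewrite ltnn in ltp.
Qed.

Lemma g_inj : injective g.
Proof.
move=> p q gpq; apply: simple'; apply/setP => u.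
have orE t : (a' t == u)%:R + (b' t == u)%:R = (u \in [set a' t; b' t])%:R :> 'F_2.
  rewrite F2_natr_addb !inE ![u == _]eq_sym; congr (_ : bool)%:R.
  by have := a'_neq t; have [->|//] := eqVneq (a' t) u; rewrite eq_sym => /negbTE ->.
have := g_part p u; rewrite gpq g_part !orE.
by do 2!case: (u \in _).
Qed.

Let gE := [set g p | p : E'].
(** The edges to be deleted: faces on both sides of such an edge become one. *)
Let D := [set e | (e \notin K) && (e \notin gE)].
Let rtF := fingraph.root (adj l r D).
Let F' := {f | rtF f == f}.
Let rtFK f : rtF (rtF f) == rtF f.
Proof. by rewrite /rtF root_root //; exact: adj_connect_sym. Qed.
Let proj f : F' := exist _ (rtF f) (rtFK f).
Let l' p := proj (l (g p)).
Let r' p := proj (r (g p)).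

Lemma projK (f : F') : proj (val f) = f.
Proof. by apply/val_inj/eqP/(valP f). Qed.

Lemma proj_D e : e \in D -> proj (l e) = proj (r e).
Proof.
move=> eD; apply/val_inj/eqP => /=; rewrite /rtF root_connect.
  exact/connect1/adj_edge.
exact: adj_connect_sym.
Qed.

Lemma descend (psi : F -> 'F_2) : (forall e, e \in D -> psi (l e) = psi (r e)) ->
  forall f, psi (val (proj f)) = psi f.
Proof.
move=> psiD f; have := connect_root (adj l r D) f.
pose C := [set h | psi h == psi f].
move/(closed_connect (C := C)); rewrite !inE eqxx => h; apply/eqP/esym/h.
by move=> e /psiD; rewrite !inE => ->.
Qed.

(** Contraction: summing a boundary over a contracted part leaves the boundary in the minor. *)
Lemma sum_part z u : (forall e, e \in D -> z e = 0) ->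
  \sum_(x in part u) bd a b z x = bd a' b' (z \o g) u.
Proof.
move=> zD; rewrite sum_bd (bigID (mem (gE))) /= [X in _ + X]big1 ?addr0.
  rewrite big_imset /=; last exact: in2W g_inj.
  by apply: eq_bigr => p _; rewrite g_part.
move=> e eg; have [eK|eK] := boolP (e \in K); first by rewrite part_edge // addF2 mulr0.
by rewrite zD ?mul0r // inE eK.
Qed.

(** A cycle of the minor is closed up by chains inside the contracted parts.  The edge [g p] is
    completed by [pi_ p] to a chain between the base points of its ends. *)
Lemma lift_cycle z' : (forall u, bd a' b' z' u = 0) ->
  exists z, [/\ forall v, bd a b z v = 0, forall p, z (g p) = z' p,
                forall e, e \in D -> z e = 0 & supported I z].
Proof.
move=> bz'.
have pi p : exists2 z, supported K z &
    forall v, bd a b z v = (a (g p) == v)%:R + (b (g p) == v)%:R +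
                       ((c (a' p) == v)%:R + (c (b' p) == v)%:R).
  have main u v x y : x \in part u -> y \in part v -> exists2 z, supported K z &
      forall w, bd a b z w = (x == w)%:R + (y == w)%:R + ((c u == w)%:R + (c v == w)%:R).
    rewrite !inE => /connect_chain[z1 z1K bz1] /connect_chain[z2 z2K bz2].
    exists (fun e => z1 e + z2 e) => [e eK|w]; first by rewrite z1K ?z2K ?addr0.
    by rewrite bdD bz1 bz2; ring.
  case/orP: (g_link p) => /andP[h1 h2]; first exact: main.
  have [z zK bz] := main _ _ _ _ h1 h2; exists z => // w; rewrite bz.
  by congr (_ + _); exact: addrC.
have [|pi_ piP] := @boolp.choice _ _ (fun p z => supported K z /\ forall v, bd a b z v =
    (a (g p) == v)%:R + (b (g p) == v)%:R + ((c (a' p) == v)%:R + (c (b' p) == v)%:R)).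
  by move=> p; have [z] := pi p; exists z.
pose z e := \sum_p z' p * ((e == g p)%:R + pi_ p e).
have zg p : z (g p) = z' p.
  rewrite /z (bigD1 p) //= eqxx (piP p).1 ?g_notK // addr0 mulr1 big1 ?addr0 // => q qp.
  by rewrite (inj_eq g_inj) eq_sym (negbTE qp) (piP q).1 ?g_notK // addr0 mulr0.
have zD e : e \in D -> z e = 0.
  rewrite inE => /andP[eK eg]; apply: big1 => p _; rewrite (piP p).1 // addr0.
  case: eqP => [ep|]; last by rewrite mulr0.
  by rewrite ep imset_f in eg.
exists z; split=> //; last first.
  move=> e eI; apply: zD; rewrite inE (contra (subsetP KI e)) //.
  by apply/imsetP => -[p _ ep]; rewrite ep gI in eI.
move=> v; transitivity (\sum_p z' p * ((c (a' p) == v)%:R + (c (b' p) == v)%:R)).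
  rewrite /bd; under eq_bigr do rewrite /z mulr_suml.
  rewrite exchange_big /=; apply: eq_bigr => p _.
  under eq_bigr do rewrite -mulrA.
  rewrite -mulr_sumr -/(bd a b (fun e => (e == g p)%:R + pi_ p e) v) bdD bd_delta (piP p).2.
  by rewrite addrA addF2 add0r.
have [/imsetP[u _ ->]|vB] := boolP (v \in c @: U).
  by rewrite -[RHS](bz' u); apply: eq_bigr => p _; rewrite !(inj_eq c_inj).
apply: big1 => p _.
have cw t : (c t == v) = false by apply: contraNF vB => /eqP <-; apply: imset_f.
by rewrite !cw addr0 mulr0.
Qed.

Lemma pullback (psi : F' -> 'F_2) e : e \in D -> coboundary l r (psi \o proj) e = 0.
Proof. by move=> eD; rewrite /coboundary /= (proj_D eD) addF2. Qed.

(** Sets of faces of the minor are sets of faces of the big graph with no deleted edge in their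
    boundary.  For connectedness, a boundary supported on [K] vanishes because [K] is a
    forest.  For the stars, restrict the boundary to the edges of [K] in the part of [u]: if no
    edge at [u] in the minor is in the boundary, this restriction is a cycle on [K], hence zero,
    and the value can be transported along the paths of [K] in the part. *)
Lemma minor_dual : plane_dual a' b' l' r'.
Proof.
split=> [psi u|z' /lift_cycle[z [bz zg zD zI]]|psi psiE|psi u psi_u].
- transitivity (\sum_(x in part u) bd a b (coboundary l r (psi \o proj)) x).
    by rewrite sum_part // => e /pullback.
  by apply: big1 => x _; exact: big_bd.
- have [psi zpsi] := big_cycle zI bz.
  have psiD e : e \in D -> psi (l e) = psi (r e).
    by move=> /zD; rewrite zpsi => /eqP; rewrite addF2_eq0 => /eqP.
  exists (psi \o val) => p; rewrite -zg zpsi /coboundary /=.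
  by rewrite !(descend psiD).
- have z0 : forall e, coboundary l r (psi \o proj) e = 0.
    apply: K_indep => [e eK|v _]; last exact: big_bd.
    have [/imsetP[p _ ->]|eg] := boolP (e \in gE); last by rewrite pullback // inE eK.
    by have /= := psiE p; rewrite /coboundary /l' /r' /= => ->; rewrite addF2.
  move=> f f'; rewrite -(projK f) -(projK f').
  apply: (big_connected (psi := psi \o proj)) => e.
  by apply/eqP; rewrite -addF2_eq0; apply/eqP/z0.
pose phi := psi \o proj.
have gu p x : x \in part u -> at_vertex a b x (g p) -> at_vertex a' b' u p.
  move=> xu /orP[]/eqP ex; rewrite -ex in xu.
    by case/orP: (g_link p) => /andP[h1 h2]; rewrite /at_vertex ?(part_uniq h1 xu) ?eqxx ?orbT.
  by case/orP: (g_link p) => /andP[h1 h2]; rewrite /at_vertex ?(part_uniq h2 xu) ?eqxx ?orbT.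
have notK x e : x \in part u -> at_vertex a b x e -> e \notin K -> coboundary l r phi e = 0.
  move=> xu xe eK; have [/imsetP[p _ ep]|eg] := boolP (e \in gE); last first.
    by rewrite pullback // inE eK.
  rewrite ep in xe *; have := psi_u p (gu _ _ xu xe).
  by rewrite /coboundary /phi /= => ->; rewrite addF2.
pose z e := if (e \in K) && (a e \in part u) then coboundary l r phi e else 0.
have z0 : forall e, z e = 0.
  apply: K_indep => [e eK|x _]; first by rewrite /z (negbTE eK).
  have [xu|xu] := boolP (x \in part u); last first.
    apply: big1 => e _; rewrite /z; case: ifP => [/andP[eK ae]|_]; last by rewrite mul0r.
    have nx y : y \in part u -> (y == x) = false by apply: contraTF => /eqP ->.
    by rewrite !nx -?(part_edge u eK) // addr0 mulr0.
  rewrite -[RHS](big_bd phi x); apply: eq_bigr => e _; rewrite /z.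
  have [xe|] := boolP (at_vertex a b x e); last first.
    by rewrite negb_or => /andP[/negbTE -> /negbTE ->]; rewrite addr0 !mulr0.
  case: ifP => // /negbT; rewrite negb_and => /orP[eK|]; first by rewrite (notK x).
  have [eK|eK] := boolP (e \in K); last by rewrite (notK x).
  by case/orP: xe => /eqP ex; [rewrite ex xu | rewrite (part_edge u eK) ex xu].
have cob0 x e : x \in part u -> at_vertex a b x e -> phi (l e) = phi (r e).
  move=> xu xe; apply/eqP; rewrite -addF2_eq0 -/(coboundary l r phi e); apply/eqP.
  have [eK|eK] := boolP (e \in K); last exact: (notK x).
  rewrite -(z0 e) /z eK; case: ifP => //.
  by case/orP: xe => /eqP ex; [rewrite ex xu | rewrite (part_edge u eK) ex xu].
have toC x e e0 : at_vertex a b (c u) e0 -> x \in part u -> at_vertex a b x e ->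
    phi (l e) = phi (l e0).
  move=> e0c; rewrite inE => cx xe.
  pose C := [set y | (y \in part u) && `[< forall e, at_vertex a b y e -> phi (l e) = phi (l e0) >]].
  have star y : y \in part u -> forall e e', at_vertex a b y e -> at_vertex a b y e' ->
      phi (l e) = phi (l e').
    by move=> yu; apply: big_star => e' ye'; apply: (cob0 y).
  have cuC : c u \in C.
    rewrite !inE connect0 /=; apply/asboolP => e' ce'.
    by apply: (star (c u)) => //; rewrite inE.
  suff : x \in C by rewrite inE => /andP[_ /asboolP]; apply.
  rewrite -(closed_connect (C := C) _ cx) // => e' e'K.
  rewrite in_set [in RHS]in_set (part_edge u e'K).
  have [bu|//] := boolP (b e' \in part u); have au := bu; rewrite -(part_edge u e'K) in au.
  have at_a : at_vertex a b (a e') e' by rewrite /at_vertex eqxx.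
  have at_b : at_vertex a b (b e') e' by rewrite /at_vertex eqxx orbT.
  apply/asboolP/asboolP => h e1 e1P.
    by rewrite (star _ bu e1 e') // h.
  by rewrite (star _ au e1 e') // h.
have atg p : at_vertex a' b' u p -> exists2 x, x \in part u & at_vertex a b x (g p).
  move=> up; case/orP: (g_link p) => /andP[h1 h2]; case/orP: up => /eqP e.
  - by exists (a (g p)); rewrite -?e // /at_vertex eqxx.
  - by exists (b (g p)); rewrite -?e // /at_vertex eqxx orbT.
  - by exists (b (g p)); rewrite -?e // /at_vertex eqxx orbT.
  - by exists (a (g p)); rewrite -?e // /at_vertex eqxx.
move=> p q up uq; have [x xu xp] := atg _ up; have [y yu yq] := atg _ uq.
have [e0 e0c] : exists e0, at_vertex a b (c u) e0.
  move: xu; rewrite inE => /connectP[[|w s] /=]; first by move=> _ <-; exists (g p).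
  move=> /andP[/exists_inP[e _ h] _] _; exists e.
  by case/orP: h => /andP[/eqP ha /eqP hb]; rewrite /at_vertex ?ha ?hb eqxx ?orbT.
have := toC _ _ _ e0c xu xp; have := toC _ _ _ e0c yu yq.
by rewrite /phi /l' /= => -> ->.
Qed.

Lemma cover u v e : u != v -> e \in I -> a e \in part u -> b e \in part v ->
  exists p : E', [set a' p; b' p] = [set u; v].
Proof.
move=> uv eI ae be; case: (ltngtP (enum_rank u) (enum_rank v)) => [lt|lt|/val_inj/enum_rank_inj uv'].
- have h : linked (u, v).
    by rewrite /linked /= lt; apply/exists_inP; exists e; rewrite // /link ae be.
  by exists (exist (fun p => is_true (linked p)) (u, v) h).
- have h : linked (v, u).
    by rewrite /linked /= lt; apply/exists_inP; exists e; rewrite // /link ae be orbT.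
  by exists (exist (fun p => is_true (linked p)) (v, u) h); rewrite setUC.
- by rewrite uv' eqxx in uv.
Qed.

Lemma minor_connected u v : connect (adj a' b' [set: E']) u v.
Proof.
have base x y : adj a b I x y -> exists w, y \in part w.
  move=> /exists_inP[e /I_base[[u1 h1] [u2 h2]] h].
  by case/orP: h => /andP[/eqP h3 /eqP h4]; [exists u2|exists u1]; rewrite inE -?h4 -?h3.
have /connectP[s] := I_connected u v.
have : c u \in part u by rewrite inE connect0.
move: (c u) => x; elim: s x u => [|y s IH] x u xu /= => [_ cv|/andP[xy sI] sv].
  by rewrite (part_uniq (v := v) xu) ?connect0 // -cv inE connect0.
have [w yw] := base _ _ xy.
apply: (connect_trans (y := w)); last exact: IH yw sI sv.
have [->|uw] := eqVneq u w; first exact: connect0.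
have [p ep] : exists p : E', [set a' p; b' p] = [set u; w].
  case/exists_inP: xy => e eI /orP[]/andP[/eqP ea /eqP eb].
    by apply: (cover uw eI); rewrite ?ea ?eb.
  rewrite setUC; apply: (cover _ eI); rewrite ?ea ?eb //.
  by rewrite eq_sym.
apply/connect1/exists_inP; exists p; rewrite ?inE //.
have /setP eu := ep; have := eu u; have := eu w; rewrite !inE !eqxx orbT /=.
move: uw => /[swap] /orP[]/eqP -> /[swap] /orP[]/eqP ->; rewrite ?eqxx ?orbT //.
Qed.

(** The faces of the minor are the classes of faces under crossing deleted edges; its edges are
    all pairs of parts joined by an edge of [I], so that it is connected along with [I]. *)
Lemma minor_exists : inhabited F -> exists (E1 F1 : finType) (a1 b1 : E1 -> U) (l1 r1 : E1 -> F1),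
  [/\ plane_dual a1 b1 l1 r1, forall e, a1 e != b1 e,
      forall e e', [set a1 e; b1 e] = [set a1 e'; b1 e'] -> e = e',
      forall u v, connect (adj a1 b1 [set: E1]) u v &
      inhabited F1 /\
      forall u v e, u != v -> e \in I -> connect (adj a b K) (c u) (a e) ->
        connect (adj a b K) (c v) (b e) -> exists p, [set a1 p; b1 p] = [set u; v]].
Proof.
move=> [f]; exists E', F', a', b', l', r'; split=> //.
- exact: minor_dual.
- exact: minor_connected.
split; first exact: inhabits (proj f).
by move=> u v e uv eI ue ve; apply: (cover uv eI); rewrite inE.
Qed.

End Minor.

(** * Branch sets from walks in a graph *)

Section BranchSets.
Variables (V E : finType) (a b : E -> V) (I : {set E}).
Variables (U W : finType) (hu hv : W -> U) (c : U -> V) (B : U -> {set V}).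
Variable P : W -> seq V.

Let radj x y := (x == y) || adj a b I x y.

Hypothesis hu_hv : forall e, hu e != hv e.
Hypothesis cB : forall u, c u \in B u.
Hypothesis B_disj : forall u v x, x \in B u -> x \in B v -> u = v.
Hypothesis B_conn : forall u x, x \in B u -> connect (adj a b (I :&: inside a b (B u))) x (c u).
Hypothesis P_path : forall e, path radj (c (hu e)) (P e).
Hypothesis P_last : forall e, last (c (hu e)) (P e) = c (hv e).
Hypothesis P_avoid : forall e x w, x \in P e -> x \in B w -> w = hu e \/ w = hv e.
Hypothesis P_disj : forall e e' x, e != e' -> x \in P e -> x \in P e' -> exists w, x \in B w.
Hypothesis I_conn : forall i u, i \in I -> connect (adj a b I) (a i) (c u).

Let free x := [forall w, x \notin B w].

(** Cut the walk when it first enters the box of its end, and keep what follows its last visit to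
    the box of its start. *)
Lemma bridge e : exists x0 s y, [/\ x0 \in B (hu e), y \in B (hv e), path radj x0 (rcons s y),
  all free s & {subset s <= P e}].
Proof.
suff main s t x0 : x0 \in B (hu e) -> path radj x0 (t ++ s) -> all free t ->
    {subset t ++ s <= P e} -> last x0 (t ++ s) \in B (hv e) ->
    exists x0 s y, [/\ x0 \in B (hu e), y \in B (hv e), path radj x0 (rcons s y),
      all free s & {subset s <= P e}].
  by apply: (main (P e) [::] (c (hu e))) => //=; rewrite P_last.
elim: s t x0 => [|w s IH] t x0 x0B.
  rewrite cats0; case/lastP: t => [|t y] pt ft _ /=.
    by move=> x0B'; have := hu_hv e; rewrite (B_disj x0B x0B') eqxx.
  move: ft; rewrite last_rcons all_rcons => /andP[/forallP fy _] yB.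
  by have := fy (hv e); rewrite yB.
rewrite cat_path last_cat /= => /and3P[pt pw ps] ft sub lastB.
have wP : w \in P e by apply: sub; rewrite mem_cat inE eqxx orbT.
have subs : {subset s <= P e}.
  by move=> y ys; apply: sub; rewrite mem_cat inE ys !orbT.
have subt : {subset t <= P e} by move=> y yt; apply: sub; rewrite mem_cat yt.
have [wu|wu] := boolP (w \in B (hu e)); first exact: (IH [::] w).
have [wv|wv] := boolP (w \in B (hv e)).
  by exists x0, t, w; split=> //; rewrite rcons_path pt.
apply: (IH (rcons t w) x0) => //.
- by rewrite -cats1 -catA cat_path pt /= pw.
- rewrite all_rcons ft andbT; apply/forallP => w'; apply/negP => ww'.
  by case: (P_avoid wP ww') => h; rewrite h in ww'; [rewrite ww' in wu|rewrite ww' in wv].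
- by rewrite -cats1 -catA.
- by rewrite -cats1 -catA last_cat.
Qed.

(** Each box, with the inner vertices of the walks which start there, is a connected branch set.
    A maximal relative forest [K0] inside the branch sets spans them; extending it within [I] to a
    maximal [K] also attaches every remaining vertex to exactly one base point. *)
Lemma branch_forest (u0 : U) : exists K : {set E}, [/\ K \subset I,
  indep a b (c @: U) K,
  forall i, i \in I -> (exists u, connect (adj a b K) (c u) (a i)) /\
                       (exists u, connect (adj a b K) (c u) (b i)) &
  forall e, exists2 i, i \in I &
    (connect (adj a b K) (c (hu e)) (a i) /\ connect (adj a b K) (c (hv e)) (b i)) \/
    (connect (adj a b K) (c (hv e)) (a i) /\ connect (adj a b K) (c (hu e)) (b i))].
Proof.
have [q qP] := @boolp.choice _ _ (fun e (t : V * seq V * V) =>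
  [/\ t.1.1 \in B (hu e), t.2 \in B (hv e), path radj t.1.1 (rcons t.1.2 t.2),
      all free t.1.2 & {subset t.1.2 <= P e}])
  (fun e => let: ex_intro x0 (ex_intro s (ex_intro y h)) := bridge e in
    ex_intro _ (x0, s, y) h).
pose Wu u := [set x | (x \in B u) || [exists e, (hu e == u) && (x \in (q e).1.2)]].
have BW u : B u \subset Wu u by apply/subsetP => x; rewrite inE => ->.
have qfree e x w : x \in (q e).1.2 -> x \in B w -> False.
  by move=> xq xw; have [_ _ _ /allP/(_ x xq)/forallP/(_ w)] := qP e; rewrite xw.
have W_disj u v x : x \in Wu u -> x \in Wu v -> u = v.
  rewrite !inE => /orP[xu|/existsP[e /andP[/eqP eu xe]]] /orP[xv|/existsP[e' /andP[/eqP ev xe']]].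
  - exact: B_disj xu xv.
  - by case: (qfree _ _ _ xe' xu).
  - by case: (qfree _ _ _ xe xv).
  rewrite -eu -ev; have [->//|ne] := eqVneq e e'.
  have [_ _ _ _ sub] := qP e; have [_ _ _ _ sub'] := qP e'.
  by have [w xw] := P_disj ne (sub _ xe) (sub' _ xe'); case: (qfree _ _ _ xe xw).
pose R0 := [set i in I | [exists u, (a i \in Wu u) && (b i \in Wu u)]].
have R0I : R0 \subset I by apply/subsetP => i; rewrite inE => /andP[].
have adjR0 u x y : x \in Wu u -> y \in Wu u -> adj a b I x y -> adj a b R0 x y.
  move=> xu yu /exists_inP[i iI h]; apply/exists_inP; exists i => //.
  rewrite inE iI; apply/existsP; exists u.
  by case/orP: h => /andP[/eqP -> /eqP ->]; rewrite xu yu.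
have R0_closed u i : i \in R0 -> (a i \in Wu u) = (b i \in Wu u).
  rewrite inE => /andP[_ /existsP[v /andP[av bv]]].
  by apply/idP/idP => h; [rewrite (W_disj _ _ _ h av)|rewrite (W_disj _ _ _ h bv)].
have W_conn u x : x \in Wu u -> connect (adj a b R0) x (c u).
  have Bc y : y \in B u -> connect (adj a b R0) y (c u).
    move=> yB; apply: sub_connect_adj (B_conn yB); apply/subsetP => i.
    rewrite !inE => /andP[-> /andP[ai bi]]; apply/existsP; exists u.
    by rewrite !inE ai bi.
  rewrite inE => /orP[|/existsP[e /andP[/eqP eu xe]]]; first exact: Bc.
  have [x0B _ + _ _] := qP e; rewrite rcons_path eu in x0B * => /andP[pq _].
  have x0W := subsetP (BW u) _ x0B.
  apply: connect_trans (Bc _ x0B); rewrite adj_connect_sym.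
  have subW : {subset (q e).1.2 <= Wu u}.
    by move=> y ye; rewrite inE; apply/orP; right; apply/existsP; exists e; rewrite eu eqxx.
  move: (q e).1.1 (q e).1.2 pq x0W subW xe {x0B} => y s; elim: s y => // w s IH y /=.
  move=> /andP[yw ps] yW subW; rewrite inE.
  have wW : w \in Wu u by apply: subW; rewrite inE eqxx.
  have cyw : connect (adj a b R0) y w.
    by case/orP: yw => [/eqP -> //|yw]; apply/connect1/(adjR0 u).
  move=> /orP[/eqP -> //|xs]; apply: connect_trans cyw _; apply: IH => //.
  by move=> t ts; apply: subW; rewrite inE ts orbT.
have cim u : c u \in c @: U by apply: imset_f.
have [K0 [_ K0R0 iK0 sp0]] := extend_indep (sub0set R0) (@indep0 V E a b (c @: U)).
have W_K0 u x : x \in Wu u -> connect (adj a b K0) (c u) x.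
  move=> xu; have [w /imsetP[v _ ->] xv] :=
    spans_connect sp0 (cim u) (W_conn _ _ xu).
  have vu : c v \in Wu u.
    rewrite -(closed_connect (C := Wu u) _ xv) // => i iK0'.
    exact/R0_closed/(subsetP K0R0).
  have vv : c v \in Wu v by apply: (subsetP (BW v)).
  by rewrite (W_disj _ _ _ vu vv) adj_connect_sym.
have [K [K0K KI iK sp]] := extend_indep (subset_trans K0R0 R0I) iK0.
have W_K u x : x \in Wu u -> connect (adj a b K) (c u) x.
  by move=> /W_K0; apply: sub_connect_adj.
have baseI x : connect (adj a b I) x (c u0) -> exists u, connect (adj a b K) (c u) x.
  move=> xc; have [w /imsetP[v _ ->] xv] :=
    spans_connect sp (cim u0) xc.
  by exists v; rewrite adj_connect_sym.
exists K; split=> // [i iI|e].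
  split; apply: baseI; first exact: I_conn.
  by apply: connect_trans (I_conn u0 iI); rewrite adj_connect_sym; apply/connect1/adj_edge.
have [x0B yB + fs _] := qP e; rewrite rcons_path => /andP[_ lasty].
have lW : last (q e).1.1 (q e).1.2 \in Wu (hu e).
  have := mem_last (q e).1.1 (q e).1.2; rewrite inE => /orP[/eqP ->|lq].
    exact: (subsetP (BW _)).
  by rewrite inE; apply/orP; right; apply/existsP; exists e; rewrite eqxx.
have yW : (q e).2 \in Wu (hv e) by apply: (subsetP (BW _)).
case/orP: lasty => [/eqP ly|/exists_inP[i iI h]].
  by rewrite ly in lW; have := hu_hv e; rewrite (W_disj _ _ _ lW yW) eqxx.
exists i => //; case/orP: h => /andP[/eqP -> /eqP ->].
  by left; split; apply: W_K.
by right; split; apply: W_K.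
Qed.

End BranchSets.

(** * The grid on a torus *)

Section Torus.
Variable p : nat.
Let T := 'I_p.+2.

(** The grid wraps around to a torus so that no cell or vertex is special; only its interior,
    which does not meet the lines [x = 0] and [y = 0], carries cycles.  The edges are indexed by
    direction (true for horizontal) and lower left end, the cells by their lower left corner. *)
Definition torus_a (e : bool * (T * T)) : T * T := e.2.
Definition torus_b (e : bool * (T * T)) : T * T :=
  if e.1 then (e.2.1 + 1, e.2.2) else (e.2.1, e.2.2 + 1).
Definition torus_l (e : bool * (T * T)) : T * T := e.2.
Definition torus_r (e : bool * (T * T)) : T * T :=
  if e.1 then (e.2.1, e.2.2 - 1) else (e.2.1 - 1, e.2.2).

Definition box (lo hi : nat * nat) : {set T * T} :=
  [set x : T * T | [&& (lo.1 <= x.1)%N, (x.1 <= hi.1)%N, (lo.2 <= x.2)%N & (x.2 <= hi.2)%N]].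

Definition interior : {set T * T} := [set x : T * T | (x.1 != 0) && (x.2 != 0)].
Definition inner_edges := inside torus_a torus_b interior.

Lemma torus_bdE z i j : bd torus_a torus_b z (i, j) =
  z (true, (i, j)) + z (true, (i - 1, j)) + z (false, (i, j)) + z (false, (i, j - 1)).
Proof.
have one h (x v : T * T) (g : T * T -> T * T) : (forall y, (g y == v) = (y == x)) ->
    \sum_y z (h, y) * (g y == v)%:R = z (h, x).
  move=> gx; rewrite (bigD1 x) //= gx eqxx mulr1 big1 ?addr0 // => y yx.
  by rewrite gx (negbTE yx) mulr0.
transitivity (\sum_h \sum_y z (h, y) * ((torus_a (h, y) == (i, j))%:R + (torus_b (h, y) == (i, j))%:R)).
  by rewrite pair_bigA /=; apply: eq_bigr => -[].
rewrite big_bool /=.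
under eq_bigr do rewrite mulrDr.
under [X in _ + X]eq_bigr do rewrite mulrDr.
rewrite !big_split /= !addrA /torus_a /torus_b /=.
rewrite (one true (i, j) _ id) // (one false (i, j) _ id) //.
rewrite (one true (i - 1, j) _ (fun y => (y.1 + 1, y.2))) => [|[y1 y2]]; last first.
  by rewrite !xpair_eqE eq_sym -subr_eq eq_sym.
by rewrite (one false (i, j - 1) _ (fun y => (y.1, y.2 + 1))) => [|[y1 y2]]; last first;
  rewrite ?xpair_eqE //= [_ + 1 == _]eq_sym -subr_eq [_ - 1 == _]eq_sym.
Qed.

Lemma torus_bd psi v : bd torus_a torus_b (coboundary torus_l torus_r psi) v = 0.
Proof.
case: v => i j; rewrite torus_bdE /coboundary /torus_l /torus_r /=.
set x1 := psi (i, j); set x2 := psi (i, _); set x3 := psi (_, j); set x4 := psi (_, _).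
rewrite (_ : _ + _ = (x1 + x1) + (x2 + x2) + (x3 + x3) + (x4 + x4)); last by ring.
by rewrite !addF2.
Qed.

Lemma ord_ind (Q : T -> Prop) : Q 0 -> (forall i, Q i -> Q (i + 1)) -> forall i, Q i.
Proof.
move=> Q0 QS i; rewrite -(natr_Zp i); elim: (val i) => [|k IH]; first exact: Q0.
by rewrite -natr1; apply: QS.
Qed.

Lemma torus_connected psi : (forall e, psi (torus_l e) = psi (torus_r e) :> 'F_2) ->
  forall f f', psi f = psi f'.
Proof.
move=> h; have base f : psi f = psi (0, 0).
  case: f => i j; transitivity (psi (i, 0)).
    elim/ord_ind: j => // j <-; have := h (true, (i, j + 1)).
    by rewrite /torus_l /torus_r /= addrK.
  elim/ord_ind: i => // i <-; have := h (false, (i + 1, 0)).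
  by rewrite /torus_l /torus_r /= addrK.
by move=> f f'; rewrite (base f) (base f').
Qed.

Lemma torus_star psi v :
  (forall e, at_vertex torus_a torus_b v e -> psi (torus_l e) = psi (torus_r e) :> 'F_2) ->
  forall e e', at_vertex torus_a torus_b v e -> at_vertex torus_a torus_b v e' ->
  psi (torus_l e) = psi (torus_l e').
Proof.
case: v => i j h; suff base e : at_vertex torus_a torus_b (i, j) e -> psi (torus_l e) = psi (i, j).
  by move=> e e' /base -> /base ->.
case: e => -[] [x y] /orP[]; rewrite /torus_a /torus_b /= => /eqP[ei ej]; rewrite -ei -ej //.
  have := h (false, (x + 1, y)); rewrite /torus_l /torus_r /= addrK => ->//.
  by rewrite /at_vertex /torus_a /= ei ej eqxx.
have := h (true, (x, y + 1)); rewrite /torus_l /torus_r /= addrK => ->//.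
by rewrite /at_vertex /torus_a /= ei ej eqxx.
Qed.
End Torus.

Section TorusCycles.
Variable p : nat.
Let T := 'I_p.+2.
Notation ta := (@torus_a p).
Notation tb := (@torus_b p).

Definition torus_pt (x : nat * nat) : T * T := (x.1%:R, x.2%:R).

Lemma val_natr k : (k < p.+2)%N -> val (k%:R : T) = k.
Proof. by move=> kp; rewrite Zp_nat /= modn_small. Qed.

(** The cell at [(i, j)] is enclosed by [z] when the ray downwards from it crosses [z] an odd number
    of times.  Crossing a horizontal edge changes the parity by definition; for a vertical edge,
    the boundary conditions on the vertices below telescope. *)
Lemma torus_cycle z : supported (inner_edges p) z -> (forall v, bd ta tb z v = 0) ->
  exists psi, forall e, z e = coboundary (@torus_l p) (@torus_r p) psi e.
Proof.
move=> zI bz.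
have out x (h : bool) : (x.1 == 0) || (x.2 == 0) -> z (h, x) = 0.
  by move=> x0; apply: zI; rewrite !inE /torus_a /= -negb_or x0.
have zlast i : z (false, (i, -1)) = 0.
  by apply: zI; rewrite !inE /torus_a /torus_b /= addNr eqxx !andbF.
(* The number of edges of [z] below the cell [(i, k)], down to the line [y = 0]. *)
pose phi i k := \sum_(0 <= m < k.+1) z (true, (i, m%:R)).
have phi0 i : phi i 0%N = 0 by rewrite /phi big_nat1 out //= eqxx orbT.
have phiS i k : phi i k.+1 = phi i k + z (true, (i, k.+1%:R)) by rewrite /phi big_nat_recr.
have predE k : k.+1%:R - 1 = k%:R :> T by rewrite -natr1 addrK.
have eq2 (s t u v : 'F_2) : s + t + u + v = 0 -> s + t = u + v.
  by rewrite -addrA => /eqP; rewrite addF2_eq0 => /eqP.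
have vert i k : phi i k + phi (i - 1) k = z (false, (i, k%:R)).
  elim: k => [|k IH]; first by rewrite !phi0 addr0 out //= eqxx orbT.
  rewrite !phiS addrACA IH (eq2 (z (true, (i, k.+1%:R))) (z (true, (i - 1, k.+1%:R))) (z (false, (i, k.+1%:R))) (z (false, (i, k%:R)))).
    by rewrite addrC -addrA addF2 addr0.
  by have := bz (i, k.+1%:R); rewrite torus_bdE predE.
have full i : phi i p.+1 = 0.
  have last_eq : p.+1%:R = -1 :> T.
    by apply/eqP; rewrite -subr_eq0 opprK natr1; apply/eqP/val_inj; rewrite Zp_nat /= modnn.
  elim/ord_ind: i => [|i IH].
    by rewrite /phi big1 // => k _; rewrite out //= eqxx.
  have := vert (i + 1) p.+1; rewrite addrK IH addr0 => ->.
  by rewrite last_eq zlast.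
exists (fun f => phi f.1 (val f.2)) => -[[] [i j]].
  change (z (true, (i, j)) = phi i (val j) + phi i (val (j - 1))).
  have [->|j0] := eqVneq j 0.
    rewrite sub0r out ?eqxx ?orbT // phi0 add0r.
    suff -> : val (- 1 : T) = p.+1 by rewrite full.
    by rewrite /= modn_small // subn1.
  have [k jk] : exists k, val j = k.+1.
    by exists (val j).-1; rewrite prednK // lt0n; apply: contra j0 => /eqP j0; apply/eqP/val_inj.
  have kp : (k.+1 < p.+2)%N by rewrite -jk ltn_ord.
  have jE : j = k.+1%:R by apply/val_inj; rewrite val_natr.
  rewrite jE predE !val_natr ?(ltnW kp) // phiS.
  by rewrite addrAC addF2 add0r.
change (z (false, (i, j)) = phi i (val j) + phi (i - 1) (val j)).
by rewrite vert natr_Zp.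
Qed.

Lemma adj_right (S : {set T * T}) i j : torus_pt (i, j) \in S -> torus_pt (i.+1, j) \in S ->
  adj ta tb (inside ta tb S) (torus_pt (i, j)) (torus_pt (i.+1, j)).
Proof.
move=> h1 h2; have e : tb (true, torus_pt (i, j)) = torus_pt (i.+1, j).
  by rewrite /torus_b /torus_pt /= natr1.
apply/exists_inP; exists (true, torus_pt (i, j)); first by rewrite inE e h1 h2.
by rewrite e /torus_a !eqxx.
Qed.

Lemma adj_up (S : {set T * T}) i j : torus_pt (i, j) \in S -> torus_pt (i, j.+1) \in S ->
  adj ta tb (inside ta tb S) (torus_pt (i, j)) (torus_pt (i, j.+1)).
Proof.
move=> h1 h2; have e : tb (false, torus_pt (i, j)) = torus_pt (i, j.+1).
  by rewrite /torus_b /torus_pt /= natr1.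
apply/exists_inP; exists (false, torus_pt (i, j)); first by rewrite inE e h1 h2.
by rewrite e /torus_a !eqxx.
Qed.

Lemma in_box lo hi i j : (i < p.+2)%N -> (j < p.+2)%N ->
  (torus_pt (i, j) \in box p lo hi) = [&& lo.1 <= i, i <= hi.1, lo.2 <= j & j <= hi.2]%N.
Proof. by move=> ip jp; rewrite inE /= !val_natr. Qed.

Lemma torus_pt_inj x y : (x.1 < p.+2)%N -> (x.2 < p.+2)%N -> (y.1 < p.+2)%N ->
  (y.2 < p.+2)%N -> torus_pt x = torus_pt y -> x = y.
Proof.
case: x y => [x1 x2] [y1 y2] /= x1p x2p y1p y2p [e1 e2].
by rewrite -(val_natr x1p) e1 val_natr // -(val_natr x2p) e2 val_natr.
Qed.

Lemma torus_ptK (x : T * T) : torus_pt (val x.1, val x.2) = x.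
Proof. by case: x => i j; rewrite /torus_pt /= !natr_Zp. Qed.

(** Walk horizontally, then vertically. *)
Lemma box_connected lo hi x y : (hi.1 < p.+2)%N -> (hi.2 < p.+2)%N ->
  x \in box p lo hi -> y \in box p lo hi ->
  connect (adj ta tb (inside ta tb (box p lo hi))) x y.
Proof.
move=> h1 h2; rewrite -(torus_ptK x) -(torus_ptK y).
case: x y => [x1 x2] [y1 y2] /=.
rewrite !in_box // => /and4P[a1 a2 a3 a4] /and4P[b1 b2 b3 b4].
set e := adj ta tb _.
have csym u v : connect e u v -> connect e v u.
  by rewrite (@adj_connect_sym _ _ ta tb (inside ta tb (box p lo hi)) u v).
have hor i i' j : (lo.1 <= i <= i')%N -> (i' <= hi.1)%N -> (lo.2 <= j <= hi.2)%N ->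
    connect e (torus_pt (i, j)) (torus_pt (i', j)).
  move=> /andP[li]; elim: i' => [|i' IH]; first by rewrite leqn0 => /eqP ->.
  rewrite leq_eqVlt => /orP[/eqP -> //|]; rewrite ltnS => ii' ih jr.
  apply: connect_trans (IH ii' (ltnW ih) jr) _; apply/connect1/adj_right; rewrite in_box /=; lia.
have ver i j j' : (lo.2 <= j <= j')%N -> (j' <= hi.2)%N -> (lo.1 <= i <= hi.1)%N ->
    connect e (torus_pt (i, j)) (torus_pt (i, j')).
  move=> /andP[li]; elim: j' => [|j' IH]; first by rewrite leqn0 => /eqP ->.
  rewrite leq_eqVlt => /orP[/eqP -> //|]; rewrite ltnS => ii' ih jr.
  apply: connect_trans (IH ii' (ltnW ih) jr) _; apply/connect1/adj_up; rewrite in_box /=; lia.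
apply: (connect_trans (y := torus_pt (val y1, val x2))).
  have [le|lt] := leqP x1 y1; first by apply: hor; rewrite ?a1 ?a3 ?a4 ?b2.
  by apply/csym/hor; rewrite ?b1 ?a3 ?a4 ?(ltnW lt).
have [le|lt] := leqP x2 y2; first by apply: ver; rewrite ?a3 ?b1 ?b2 ?b4.
by apply/csym/ver; rewrite ?b3 ?b1 ?b2 ?(ltnW lt).
Qed.

End TorusCycles.

Lemma inside_sub (V E : finType) (a b : E -> V) (S S' : {set V}) :
  S \subset S' -> inside a b S \subset inside a b S'.
Proof.
move=> /subsetP SS'; apply/subsetP => e; rewrite !inE => /andP[ae be].
by rewrite !SS'.
Qed.

(** Maximum distance at most [m] on the grid. *)
Definition near (m : nat) (x y : nat * nat) :=
  [&& x.1 <= y.1 + m, y.1 <= x.1 + m, x.2 <= y.2 + m & y.2 <= x.2 + m]%N.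

Lemma grid_near_refl m x : near m x x.
Proof. by rewrite /near !leq_addr. Qed.

Lemma grid_near_join m x y z : near m x y -> near m x z -> near (m + m) y z.
Proof.
move=> /and4P[? ? ? ?] /and4P[? ? ? ?]; apply/and4P; split; lia.
Qed.

Definition grid_step (x y : nat * nat) := near 1 x y && ((x.1 == y.1) || (x.2 == y.2)).

(** A drawing by walks on a grid exhibits the graph as a minor of the torus, up to further edges:
    the vertices are boxes of radius [m], and the walks are disjoint outside the boxes. *)
Lemma grid_certificate (U W : finType) (hu hv : W -> U) (N m : nat)
    (pos : U -> nat * nat) (P : W -> seq (nat * nat)) (u0 : U) :
  (forall e, hu e != hv e) ->
  (forall u, [&& m < (pos u).1, (pos u).1 + m < N, m < (pos u).2 & (pos u).2 + m < N]%N) ->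
  (forall u v x, near m x (pos u) -> near m x (pos v) -> u = v) ->
  (forall e, path grid_step (pos (hu e)) (P e)) ->
  (forall e, last (pos (hu e)) (P e) = pos (hv e)) ->
  (forall e x, x \in P e -> [&& 0 < x.1, x.1 < N, 0 < x.2 & x.2 < N]%N) ->
  (forall e x w, x \in P e -> near m x (pos w) -> w = hu e \/ w = hv e) ->
  (forall e e' x, e != e' -> x \in P e -> x \in P e' -> exists w, near m x (pos w)) ->
  exists (E1 F1 : finType) (a1 b1 : E1 -> U) (l1 r1 : E1 -> F1),
  [/\ plane_dual a1 b1 l1 r1, forall e, a1 e != b1 e,
      forall e e', [set a1 e; b1 e] = [set a1 e'; b1 e'] -> e = e',
      forall u v, connect (adj a1 b1 [set: E1]) u v &
      inhabited F1 /\
      forall e, exists p, [set a1 p; b1 p] = [set hu e; hv e]].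
Proof.
move=> huv posN pos_inj P_path P_last P_range P_avoid P_disj.
pose c u := torus_pt N (pos u).
pose B u := box N ((pos u).1 - m, (pos u).2 - m)%N ((pos u).1 + m, (pos u).2 + m)%N.
have BE u x : (x.1 < N.+2)%N -> (x.2 < N.+2)%N ->
    (torus_pt N x \in B u) = near m x (pos u).
  by move=> x1 x2; case: x x1 x2 => i j /= ? ?; rewrite in_box //= /near /=; lia.
have B_near u (x : 'I_N.+2 * 'I_N.+2) : (x \in B u) = near m (val x.1, val x.2) (pos u).
  by rewrite -{1}(torus_ptK x) BE //; exact: ltn_ord.
have pos_lt u : ((pos u).1 < N.+2)%N /\ ((pos u).2 < N.+2)%N by have := posN u; lia.

have nearxx x : near m x x := grid_near_refl m x.
have Bint u : B u \subset interior N.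
  apply/subsetP => x; rewrite B_near inE /near /= => h; have := posN u.
  rewrite -!(inj_eq val_inj) /=; lia.
have intE : interior N = box N (1, 1)%N (N.+1, N.+1).
  apply/setP => -[i j]; rewrite !inE /= -!(inj_eq val_inj) /=.
  have := ltn_ord i; have := ltn_ord j; lia.
have intc x y : x \in interior N -> y \in interior N ->
    connect (adj (@torus_a N) (@torus_b N) (inner_edges N)) x y.
  by rewrite /inner_edges intE; apply: box_connected.
have cint u : c u \in interior N.
  by apply: (subsetP (Bint u)); have [? ?] := pos_lt u; rewrite BE.
have P_lt e x : x \in P e -> (x.1 < N.+2)%N /\ (x.2 < N.+2)%N.
  by move=> /P_range; lia.
have [||||||||K [KI iK I_base bridgeK]] := @branch_forest _ _ (@torus_a N) (@torus_b N)
    (inner_edges N) U W hu hv c B (fun e => map (torus_pt N) (P e)) huv _ _ _ _ _ _ _ _ u0.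
- by move=> u; have [? ?] := pos_lt u; rewrite BE.
- by move=> u v x; rewrite !B_near; apply: pos_inj.
- move=> u x xB; have cB : c u \in B u by have [? ?] := pos_lt u; rewrite BE.
  have := @box_connected N _ _ x (c u) _ _ xB cB; rewrite -/(B u) /=.
  have := posN u => pu; move=> /(_ ltac:(lia) ltac:(lia)).
  apply: sub_connect_adj; rewrite subsetI subxx andbT.
  exact: inside_sub.
- move=> e; rewrite /c path_map.
  pose inr (x : nat * nat) := [&& 0 < x.1, x.1 < N, 0 < x.2 & x.2 < N]%N.
  apply: (sub_in_path (P := inr) (e := grid_step) _ _ (P_path e)); last first.
    apply/andP; split; last by apply/allP => x /P_range.
    by rewrite /inr; have := posN (hu e); lia.
  move=> x y xr yr /andP[xy1 xy2] /=; apply/orP.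
  have int z : z \in inr -> torus_pt N z \in interior N.
    case: z => z1 z2; rewrite unfold_in /inr intE /= => h.
    by rewrite in_box /=; lia.
  have csym u v : adj (@torus_a N) (@torus_b N) (inner_edges N) u v =
      adj (@torus_a N) (@torus_b N) (inner_edges N) v u by apply: adj_sym.
  have := int _ xr; have := int _ yr; clear xr yr.
  case: x y xy1 xy2 => [i j] [i' j']; rewrite /near /= => h /orP[]/eqP e1 iy ix; rewrite e1 in ix h *.
    have [->|[jj|jj]] : j = j' \/ (j' = j.+1 \/ j = j'.+1) by lia.
    + by left.
    + by right; rewrite jj in iy *; apply: adj_up.
    + by right; rewrite csym jj in ix *; apply: adj_up.
  have [->|[jj|jj]] : i = i' \/ (i' = i.+1 \/ i = i'.+1) by lia.
  + by left.
  + by right; rewrite jj in iy *; apply: adj_right.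
  + by right; rewrite csym jj in ix *; apply: adj_right.
- by move=> e; rewrite /c last_map P_last.
- move=> e x w /mapP[y yP ->]; have [? ?] := P_lt _ _ yP; rewrite BE //; exact: P_avoid yP.
- move=> e e' x ne /mapP[y yP ->] /mapP[y' yP' eq_pt].
  have [y1 y2] := P_lt _ _ yP; have [y1' y2'] := P_lt _ _ yP'.
  have yy : y = y' by apply: torus_pt_inj eq_pt.
  have [w yw] := P_disj _ _ _ ne yP (eq_ind_r (fun t => t \in P e') yP' yy).
  by exists w; rewrite BE.
- move=> i u; rewrite inE => /andP[ai _]; exact: intc.
have [|E1 [F1 [a1 [b1 [l1 [r1 [dual loopless simple conn [inhF cover]]]]]]]] :=
  minor_exists (@torus_bd N) (@torus_cycle N) (@torus_connected N) (@torus_star N)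
    _ KI iK I_base (fun u v => intc _ _ (cint u) (cint v)) (inhabits (0, 0)).
  move=> u v cuv; apply: (pos_inj u v (pos u)); first exact: grid_near_refl.
  have [h1 h2] := pos_lt u; have [h1' h2'] := pos_lt v.
  by rewrite (torus_pt_inj h1 h2 h1' h2' cuv) grid_near_refl.
exists E1, F1, a1, b1, l1, r1; split=> //; split=> // e.
have [i iI [[h1 h2]|[h1 h2]]] := bridgeK e; first exact: cover (huv e) iI h1 h2.
have [|q qP] := cover (hv e) (hu e) i _ iI h1 h2; first by rewrite eq_sym.
by exists q; rewrite qP setUC.
Qed.

(** * From continuous arcs to walks on a grid *)

Section Compactness.
Local Open Scope classical_set_scope.
Variable R : realType.

Definition clamp (t : R) : R := if t < 0 then 0 else if 1 < t then 1 else t.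

Lemma clamp_itv t : 0 <= clamp t <= 1.
Proof.
by rewrite /clamp; case: (ltP t 0) => h1; case: (ltP 1 t) => h2; apply/andP; split; lra.
Qed.

Lemma clamp_id t : 0 <= t <= 1 -> clamp t = t.
Proof.
by move=> /andP[t0 t1]; rewrite /clamp; case: (ltP t 0) => h1; case: (ltP 1 t) => h2; lra.
Qed.

Lemma clamp_lip s t : `|clamp s - clamp t| <= `|s - t|.
Proof.
have := ler_norm (s - t); have := ler_norm (t - s); rewrite distrC ler_norml /clamp.
case: (ltP s 0) => h1; case: (ltP 1 s) => h2; case: (ltP t 0) => h3; case: (ltP 1 t) => h4;
  by move=> ? ?; apply/andP; split; lra.
Qed.

(** Extending an arc constantly beyond its ends makes it continuous on the whole line, so that
    continuity need not be relativized to an interval. *)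
Lemma clamp_continuous (T : topologicalType) (f : R -> T) :
  {within `[0, 1], continuous f} -> continuous (f \o clamp).
Proof.
move=> /subspace_continuousP cf t A.
have c01 s : `[0, 1]%classic (clamp s) by rewrite /= in_itv /= clamp_itv.
move=> /(cf _ (c01 t)); rewrite /= /within /= => /nbhs_ballP[e /= e0 he].
apply/nbhs_ballP; exists e => // s; rewrite -ball_normE /= => ts.
apply: he; last exact: c01.
by rewrite -ball_normE /=; apply: le_lt_trans ts; apply: clamp_lip.
Qed.

(** Heine's theorem, from the covering form of the compactness of the unit interval. *)
Lemma uniform_continuity (f : R -> R * R) (e : R) : continuous f -> 0 < e ->
  exists2 d : R, 0 < d & forall s t : R, 0 <= s <= 1 -> `|s - t| < d -> `|f s - f t| < e.
Proof.
move=> cf e0.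
have H (s : R) : \forall s' \near s & d \near 0^'+, forall t, `|s' - t| < d -> `|f s' - f t| < e.
  have /cvgrPdist_lt/(_ (e / 2)) := cf s; rewrite divr_gt0 // => /(_ isT)/nbhs_ballP[r /= r0 hr].
  exists (ball s (r / 2), [set d | 0 < d < r / 2]) => /=.
    split; first by apply: nbhsx_ballx; rewrite divr_gt0.
    by near=> d; apply/andP; split; near: d; [exact: nbhs_right_gt | apply: nbhs_right_lt; rewrite divr_gt0].
  move=> [s' d] /= [ss' /andP[d0 dr]] t s't; rewrite -ball_normE /= in ss'.
  have h1 := hr s'; have h2 := hr t; rewrite -!ball_normE /= in h1 h2.
  have st : `|s - t| < r.
    by rewrite -(subrKA s'); apply: le_lt_trans (ler_normD _ _) _; lra.
  have := h1 ltac:(lra); have := h2 st => a1 a2.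
  rewrite -(subrKA (f s)); apply: le_lt_trans (ler_normD _ _) _.
  by rewrite [`|f s' - _|]distrC; lra.
have near_d := (compact_near_coveringP _).1 (@segment_compact R 0 1) R (0^'+)
  (fun d s => forall t, `|s - t| < d -> `|f s - f t| < e) _ (fun s _ => H s).
near (0 : R)^'+ => d; exists d; first by near: d; exact: nbhs_right_gt.
move=> s t s01; have : `[0, 1] `<=` (fun s => forall t, `|s - t| < d -> `|f s - f t| < e).
  near: d; exact: near_d.
by apply; rewrite /= in_itv.
Unshelve. all: by end_near. Qed.

End Compactness.

Section Drawing.
Local Open Scope classical_set_scope.
Variable R : realType.

Lemma norm_pair_lt (x : R * R) (e : R) : (`|x| < e) = (`|x.1| < e) && (`|x.2| < e).
Proof. by rewrite prod_normE gt_max. Qed.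

Lemma uniform_pos (I : finType) (Q : I -> R -> Prop) :
  (forall i, exists2 e : R, 0 < e & Q i e) ->
  (forall i e e', e' <= e -> Q i e -> Q i e') ->
  exists2 e : R, 0 < e & forall i, Q i e.
Proof.
move=> exQ mono.
have [e he] := @boolp.choice _ _ (fun i e => 0 < e /\ Q i e)
  (fun i => let: ex_intro2 e e0 Qe := exQ i in ex_intro _ e (conj e0 Qe)).
exists (\big[Num.min/1]_i e i).
  by apply/bigmin_gtP; split=> // i _; have [] := he i.
by move=> i; have [_] := he i; apply: mono; apply: bigmin_le_cond.
Qed.

Lemma uniform_ub (I : finType) (Q : I -> R -> Prop) :
  (forall i, exists e : R, Q i e) -> (forall i e e', e <= e' -> Q i e -> Q i e') ->
  exists e : R, forall i, Q i e.
Proof.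
move=> exQ mono; have [e he] := @boolp.choice _ _ Q exQ.
exists (\big[Num.max/0]_i e i) => i; apply: mono (he i).
exact: le_bigmax_cond.
Qed.

Lemma pos_min2 (g : R * R -> R) : continuous g ->
  (forall s t, 0 <= s <= 1 -> 0 <= t <= 1 -> 0 < g (s, t)) ->
  exists2 e : R, 0 < e & forall s t, 0 <= s <= 1 -> 0 <= t <= 1 -> e <= g (s, t).
Proof.
move=> cg g0; pose K := `[(0:R), 1] `*` `[(0:R), 1].
have cK : compact K by apply: compact_setX; exact: segment_compact.
have K0 : K !=set0 by exists (0, 0); rewrite /K /= !in_itv /= lexx ler01.
have [[s t]] := compact_EVT_min K0 cK (continuous_subspaceT cg).
rewrite in_setE /K /= !in_itv /= => -[s01 t01] min; exists (g (s, t)); first exact: g0.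
by move=> s' t' s'01 t'01; apply: min; rewrite in_setE /K /= !in_itv /=.
Qed.

Lemma pos_min1 (g : R -> R) : continuous g -> (forall t, 0 <= t <= 1 -> 0 < g t) ->
  exists2 e : R, 0 < e & forall t, 0 <= t <= 1 -> e <= g t.
Proof.
move=> cg g0; have [||e e0 he] := @pos_min2 (g \o fst).
- by move=> x; apply: continuous_comp; [exact: cvg_fst | exact: cg].
- by move=> s t s01 _; apply: g0.
by exists e => // t t01; apply: (he t t).
Qed.

Lemma norm_bound (f : R -> R * R) : continuous f ->
  exists M : R, forall t, 0 <= t <= 1 -> `|f t| <= M.
Proof.
move=> cf; have [||c _ cmax] := @EVT_max R (fun t => `|f t|) 0 1.
- exact: ler01.
- by apply: continuous_subspaceT => t; apply: cvg_norm; exact: cf.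
by exists `|f c| => t t01; apply: cmax; rewrite in_itv.
Qed.

(** The arcs can only meet at their ends.  The penalty [pen] is positive close to the ends of [f] and
    zero far from them, so distance plus penalty is positive everywhere, hence bounded below by
    compactness; far from the ends this is a bound on the distance. *)
Lemma separate_arcs (f g : R -> R * R) (th : R) : continuous f -> continuous g -> 0 < th ->
  (forall s t, 0 < s < 1 -> 0 <= t <= 1 -> f s <> g t) ->
  exists2 d : R, 0 < d & forall s t, 0 <= s <= 1 -> 0 <= t <= 1 ->
    th <= `|f s - f 0| -> th <= `|f s - f 1| -> d <= `|f s - g t|.
Proof.
move=> cf cg th0 fg.
(* Twice the positive part of [th - x]. *)
pose pen (x : R) : R := (th - x) + `|th - x|.
pose h (x : R * R) : R := `|f x.1 - g x.2| + (pen `|f x.1 - f 0| + pen `|f x.1 - f 1|).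
have pen0 x : 0 <= pen x.
  by rewrite /pen; have := ler_norm (- (th - x)); rewrite normrN; lra.
have pen_far x : th <= x -> pen x = 0.
  by move=> le; rewrite /pen ler0_norm; lra.
have [||d d0 hd] := @pos_min2 h.
- have cf1 : continuous (fun x : R * R => f x.1).
    by move=> x; apply: continuous_comp; [exact: cvg_fst | exact: cf].
  have cg2 : continuous (fun x : R * R => g x.2).
    by move=> x; apply: continuous_comp; [exact: cvg_snd | exact: cg].
  have cdist p : continuous (fun x : R * R => `|f x.1 - p|).
    by move=> x; apply: cvg_norm; apply: cvgB; [exact: cf1 | exact: cvg_cst].
  have cpen u : continuous u -> continuous (fun x : R * R => pen (u x)).
    move=> cu x; have cthu : (th - u y @[y --> x] --> th - u x).
      by apply: cvgB; [exact: cvg_cst | exact: cu].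
    by apply: cvgD => //; apply: cvg_norm.
  move=> x; apply: cvgD; last first.
    by apply: cvgD; [exact: (cpen _ (cdist (f 0)) x) | exact: (cpen _ (cdist (f 1)) x)].
  by apply: cvg_norm; apply: cvgB; [exact: cf1 | exact: cg2].
- move=> s t s01 t01; rewrite /h /=.
  have [->|s0] := eqVneq s 0.
    apply: ltr_wpDl => //; apply: ltr_pwDl => //.
    by rewrite subrr normr0 /pen subr0 gtr0_norm // addr_gt0.
  have [->|s1] := eqVneq s 1.
    apply: ltr_wpDl => //; apply: ltr_wpDl => //.
    by rewrite subrr normr0 /pen subr0 gtr0_norm // addr_gt0.
  apply: ltr_pwDl; last exact: addr_ge0.
  rewrite normr_gt0 subr_eq0; apply/eqP/fg => //.
  by move: s01 => /andP[? ?]; rewrite !lt_neqAle eq_sym s0 s1; apply/andP.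
exists d => // s t s01 t01 h0 h1; have := hd s t s01 t01.
by rewrite /h /= !pen_far // !addr0.
Qed.

End Drawing.

Section Mesh.
Local Open Scope classical_set_scope.
Variables (R : realType) (eta M : R).
Hypothesis eta0 : 0 < eta.

Definition cell1 (x : R) : nat := Num.truncn ((x + M) / eta).
(** Square of the mesh of width [eta] which contains [x]; the offset [M] makes the coordinates of the
    squares natural numbers. *)
Definition cell (x : R * R) := (cell1 x.1, cell1 x.2).

Lemma cell1P x : - M <= x -> (cell1 x)%:R * eta <= x + M < (cell1 x)%:R * eta + eta.
Proof.
move=> xM; have /truncn_itv : 0 <= (x + M) / eta by apply: divr_ge0; [lra | exact: ltW].
rewrite -/(cell1 x) ler_pdivlMr // ltr_pdivrMr // => /andP[-> /=].
by rewrite -natr1 mulrDl mul1r.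
Qed.

Lemma cell1_near x y n : - M <= x -> - M <= y -> (cell1 x <= cell1 y + n)%N ->
  x - y < n%:R * eta + eta.
Proof.
move=> /cell1P/andP[x1 x2] /cell1P/andP[y1 y2]; rewrite -(ler_nat R) natrD => h.
have : (cell1 x)%:R * eta <= (cell1 y)%:R * eta + n%:R * eta by rewrite -mulrDl ler_pM2r.
lra.
Qed.

Lemma cell1_far x y n : - M <= x -> - M <= y -> (cell1 y + n < cell1 x)%N ->
  n%:R * eta < x - y.
Proof.
move=> /cell1P/andP[x1 x2] /cell1P/andP[y1 y2]; rewrite -(ler_nat R) -natr1 natrD => h.
have : (cell1 y)%:R * eta + n%:R * eta + 1 * eta <= (cell1 x)%:R * eta.
  by rewrite -!mulrDl ler_pM2r.
lra.
Qed.

Lemma cell1_step x y : - M <= x -> - M <= y -> x - y < eta -> (cell1 x <= cell1 y + 1)%N.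
Proof.
move=> xM yM xy; rewrite leqNgt; apply/negP => /(cell1_far xM yM).
by rewrite mul1r; lra.
Qed.

Definition in_frame (x : R * R) := `|x| <= M.

Lemma in_frameP x : in_frame x -> [/\ - M <= x.1, x.1 <= M, - M <= x.2 & x.2 <= M].
Proof.
by rewrite /in_frame prod_normE ge_max !ler_norml => /andP[/andP[? ?] /andP[? ?]].
Qed.

Lemma near_dist n x y : in_frame x -> in_frame y -> near n (cell x) (cell y) ->
  `|x - y| < n%:R * eta + eta.
Proof.
move=> /in_frameP[x1 _ x2 _] /in_frameP[y1 _ y2 _] /and4P[a1 a2 a3 a4].
rewrite norm_pair_lt /= !ltr_norml; have := cell1_near x1 y1 a1; have := cell1_near y1 x1 a2.
have := cell1_near x2 y2 a3; have := cell1_near y2 x2 a4 => b1 b2 b3 b4.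
by apply/andP; split; apply/andP; split; lra.
Qed.

Lemma far_dist n x y : in_frame x -> in_frame y -> ~~ near n (cell x) (cell y) ->
  n%:R * eta <= `|x - y|.
Proof.
move=> /in_frameP[x1 _ x2 _] /in_frameP[y1 _ y2 _]; apply: contraNle.
rewrite norm_pair_lt /= !ltr_norml => /andP[/andP[a1 a2] /andP[a3 a4]].
by apply/and4P; split; rewrite leqNgt; apply/negP => /cell1_far; move=> h;
  have := h ltac:(assumption) ltac:(assumption); lra.
Qed.

(** Squares of consecutive sample points may touch only at a corner, so a square next to both is
    inserted between them. *)
Fixpoint walk (y : nat -> R * R) k : seq (nat * nat) :=
  if k is k'.+1 then walk y k' ++ [:: cell ((y k).1, (y k').2); cell (y k)] else [::].

Lemma walkP y k : (forall i, (i <= k)%N -> in_frame (y i)) ->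
  (forall i, (i < k)%N -> `|y i.+1 - y i| < eta) ->
  [/\ path grid_step (cell (y 0%N)) (walk y k), last (cell (y 0%N)) (walk y k) = cell (y k) &
      forall q, q \in walk y k ->
        exists i z, [/\ (i <= k)%N, in_frame z, `|z - y i| < eta & q = cell z]].
Proof.
elim: k => [|k IH] fr st; first by split.
have [|i ik|pk lk wk] := IH; first by move=> i ik; apply: fr; apply: leqW.
  by apply: st; apply: leqW.
have fk := fr k (leqnSn k); have fk1 := fr k.+1 (leqnn _).
have [a1 a2 a3 a4] := in_frameP fk; have [b1 b2 b3 b4] := in_frameP fk1.
have := st k (leqnn _); rewrite norm_pair_lt /= => /andP[s1 s2].
split.
- rewrite cat_path pk lk /= andbT /grid_step /near /cell /= !eqxx !orbT !andbT.
  move: s1 s2; rewrite !ltr_norml => /andP[? ?] /andP[? ?].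
  by rewrite !leq_addr !andbT /=; apply/andP; split; apply/andP; split; apply: cell1_step => //; lra.
- by rewrite last_cat.
move=> q; rewrite mem_cat !inE => /orP[/wk[i [z [ik ? ? ?]]]|/orP[] /eqP ->].
- by exists i, z; split=> //; apply: leqW.
- exists k, ((y k.+1).1, (y k).2); split=> //.
    by rewrite /in_frame prod_normE ge_max /= !ler_norml; apply/andP; split; apply/andP.
  by rewrite norm_pair_lt /= s1 subrr normr0.
- by exists k.+1, (y k.+1); split=> //; rewrite subrr normr0.
Qed.

End Mesh.

Lemma dist_tri3 (R : realType) (x z z' y : R * R) :
  `|x - y| <= `|z - x| + `|z - z'| + `|z' - y|.
Proof.
rewrite -(subrKA z) -(subrKA z' z (- y)) (le_trans (ler_normD _ _)) // distrC -[leRHS]addrA lerD2l.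
exact: ler_normD.
Qed.

Section GridDrawing.
Local Open Scope classical_set_scope.
Variables (R : realType) (U W : finType) (hu hv : W -> U).
Variables (pos : U -> R * R) (F : W -> R -> R * R).
Hypothesis contF : forall e, continuous (F e).
Hypothesis F0 : forall e, F e 0 = pos (hu e).
Hypothesis F1 : forall e, F e 1 = pos (hv e).
Hypothesis pos_inj : injective pos.
Hypothesis F_avoid : forall e t w, 0 < t < 1 -> F e t <> pos w.
Hypothesis F_disj : forall e e' s t, e != e' -> 0 < s < 1 -> 0 <= t <= 1 -> F e s <> F e' t.

(** Let [eps] bound from below the distances between vertices and from vertices to arcs not ending
    there.  Away from the vertices, by at least [eps / 8], different arcs have a distance of at least [d].
    With mesh width [eta] and boxes of radius [m] squares, where [m * eta = eps / 4], boxes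
    are disjoint, arcs avoid the boxes of other vertices, and squares close to two arcs are
    within a box, as soon as [eta] is small compared to [d]. *)
Lemma grid_drawing : exists (N m : nat) (p : U -> nat * nat) (P : W -> seq (nat * nat)),
  [/\ forall u, [&& m < (p u).1, (p u).1 + m < N, m < (p u).2 & (p u).2 + m < N]%N,
      forall u v x, near m x (p u) -> near m x (p v) -> u = v,
      forall e, path grid_step (p (hu e)) (P e) /\ last (p (hu e)) (P e) = p (hv e),
      forall e x, x \in P e -> [&& 0 < x.1, x.1 < N, 0 < x.2 & x.2 < N]%N &
      (forall e x w, x \in P e -> near m x (p w) -> w = hu e \/ w = hv e) /\
      (forall e e' x, e != e' -> x \in P e -> x \in P e' -> exists w, near m x (p w))].
Proof.
have [M1 hM1] : exists M, forall u, `|pos u| <= M.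
  by apply: (uniform_ub (Q := fun u M => `|pos u| <= M)) => [u|u M M' le]; [exists `|pos u| | move=> h; exact: le_trans le].
have [M2 hM2] : exists M, forall e t, 0 <= t <= 1 -> `|F e t| <= M.
  apply: (uniform_ub (Q := fun e M => forall t, 0 <= t <= 1 -> `|F e t| <= M)) => [e|e M M' le h t t01].
    exact: norm_bound.
  exact: le_trans (h t t01) le.
pose M0 := Num.max M1 M2.
have posM u : `|pos u| <= M0 by rewrite le_max hM1.
have FM e t : 0 <= t <= 1 -> `|F e t| <= M0 by move=> t01; rewrite le_max hM2 ?orbT.
have [e1 e10 he1] : exists2 e : R, 0 < e & forall uv : U * U, uv.1 != uv.2 -> e <= `|pos uv.1 - pos uv.2|.
  apply: (uniform_pos (Q := fun uv e => uv.1 != uv.2 -> e <= `|pos uv.1 - pos uv.2|)) => [[u v]|uv e e' le h /h] /=.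
    have [->|uv] := eqVneq u v; first by exists 1.
    exists `|pos u - pos v| => //; rewrite normr_gt0 subr_eq0.
    by apply: contra uv => /eqP/pos_inj ->.
  exact: le_trans.
pose Q2 (ew : W * U) (e : R) := ew.2 != hu ew.1 -> ew.2 != hv ew.1 ->
  forall t, 0 <= t <= 1 -> e <= `|F ew.1 t - pos ew.2|.
have [e2 e20 he2] : exists2 e : R, 0 < e & forall ew, Q2 ew e.
  apply: uniform_pos => [[f w]|ew e e' le h a1 a2 t t01]; last exact: le_trans le (h a1 a2 t t01).
  have [wu|wu] := eqVneq w (hu f); first by exists 1; rewrite /Q2 /= ?wu ?eqxx.
  have [wv|wv] := eqVneq w (hv f); first by exists 1; rewrite /Q2 /= ?wv ?eqxx.
  have [||e e0 he] := @pos_min1 R (fun t => `|F f t - pos w|).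
  - by move=> t; apply: cvg_norm; apply: cvgB; [exact: contF | exact: cvg_cst].
  - move=> t /andP[t0 t1]; rewrite normr_gt0 subr_eq0.
    have [->|tn0] := eqVneq t 0.
      by rewrite F0 (inj_eq pos_inj) eq_sym.
    have [->|tn1] := eqVneq t 1.
      by rewrite F1 (inj_eq pos_inj) eq_sym.
    by apply/eqP/F_avoid; rewrite !lt_neqAle eq_sym tn0 tn1 t0.
  by exists e => // _ _.
pose eps := Num.min e1 e2.
have eps0 : 0 < eps by rewrite lt_min e10.
pose Q3 (ee : W * W) (d : R) := ee.1 != ee.2 -> forall s t, 0 <= s <= 1 -> 0 <= t <= 1 ->
  eps / 8 <= `|F ee.1 s - F ee.1 0| -> eps / 8 <= `|F ee.1 s - F ee.1 1| ->
  d <= `|F ee.1 s - F ee.2 t|.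
have [d d0 hd] : exists2 d : R, 0 < d & forall ee, Q3 ee d.
  apply: uniform_pos => [[e e']|ee d d' le h ne s t s01 t01 a1 a2]; last first.
    exact: le_trans le (h ne s t s01 t01 a1 a2).
  have [ee|ee] := eqVneq e e'; first by exists 1; rewrite /Q3 /= ?ee ?eqxx.
  have th0 : 0 < eps / 8 by lra.
  have [d d0 hd] := separate_arcs (@contF e) (@contF e') th0 (fun s t => @F_disj e e' s t ee).
  by exists d => // _.
(* Large enough for [4 * eta <= d] below; the boxes need [m >= 2]. *)
pose m := (Num.truncn (eps / d)).+2.
pose k : R := m%:R.
have k2 : 2 <= k by rewrite /k ler_nat.
have kd : eps <= k * d.
  rewrite -ler_pdivrMr //; apply: le_trans (ltW (truncnS_gt _)) _.
  by rewrite /k ler_nat.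
pose eta := eps / (4 * k).
have k0 : 0 < k by lra.
have eta0 : 0 < eta by rewrite divr_gt0 // mulr_gt0.
pose kap := k * eta.
have epsE : eps = 4 * kap by rewrite /kap /eta; field; lra.
have kap2 : 2 * eta <= kap by rewrite /kap ler_pM2r.
have etad : 4 * eta <= d.
  rewrite -(ler_pM2l k0) mulrCA -/kap; lra.
pose M := M0 + eps.
have frame_pos u : in_frame M (pos u) by rewrite /in_frame /M; have := posM u; lra.
have frame_F e t : 0 <= t <= 1 -> in_frame M (F e t).
  by move=> t01; rewrite /in_frame /M; have := FM e t t01; lra.
pose c := cell eta M.
pose N := (cell1 eta M M + m + 1)%N.
have cell_lt x : x <= M -> (cell1 eta M x + m < N)%N.
  move=> xM; rewrite /N addn1 ltnS leq_add2r /cell1 le_truncn // ler_pM2r ?invr_gt0 //.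
  by rewrite lerD2r.
have m_lt x : - M0 <= x -> (m < cell1 eta M x)%N.
  move=> xM0; rewrite ltnNge; apply/negP => le.
  have /(cell1P eta0)/andP[_] : - M <= x by rewrite /M; lra.
  have : (cell1 eta M x)%:R * eta <= kap by rewrite /kap ler_pM2r // ler_nat.
  by rewrite /M; lra.
have cell_gt0 x : - M0 - eta < x -> (0 < cell1 eta M x)%N.
  move=> xM0; rewrite lt0n; apply/negP => /eqP e0.
  have /(cell1P eta0)/andP[_] : - M <= x by rewrite /M; lra.
  by rewrite e0 mul0r /M; lra.
have pos_itv u : [/\ - M0 <= (pos u).1, (pos u).1 <= M, - M0 <= (pos u).2 & (pos u).2 <= M].
  have := posM u; rewrite prod_normE ge_max !ler_norml => /andP[/andP[? ?] /andP[? ?]].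
  by rewrite /M; split => //; lra.
have chain e : exists y n, [/\ y 0%N = pos (hu e), y n = pos (hv e),
    forall i, (i <= n)%N -> exists2 t, 0 <= t <= 1 & y i = F e t &
    forall i, (i < n)%N -> `|y i.+1 - y i| < eta].
  have [r r0 hr] := uniform_continuity (@contF e) eta0.
  pose n := (Num.truncn r^-1).+1; have n0 : 0 < n%:R :> R by rewrite ltr0n.
  have nr : n%:R^-1 < r by rewrite -[ltRHS]invrK ltf_pV2 ?posrE ?invr_gt0 // truncnS_gt.
  have itv i : (i <= n)%N -> 0 <= (i%:R / n%:R : R) <= 1.
    by move=> ni; rewrite divr_ge0 //= ler_pdivrMr // mul1r ler_nat.
  exists (fun i => F e (i%:R / n%:R)), n; split.
  - by rewrite mul0r F0.
  - by rewrite divff ?gt_eqF // F1.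
  - by move=> i ni; exists (i%:R / n%:R); [exact: itv|].
  move=> i ni; rewrite distrC; apply: hr; first exact/itv/ltnW.
  by rewrite -mulrBl -natr1 opprD addrA subrr sub0r mulN1r normrN gtr0_norm ?invr_gt0.
have [yn ynP] := @boolp.choice _ _ (fun e (yn : (nat -> R * R) * nat) =>
    [/\ yn.1 0%N = pos (hu e), yn.1 yn.2 = pos (hv e),
    forall i, (i <= yn.2)%N -> exists2 t, 0 <= t <= 1 & yn.1 i = F e t &
    forall i, (i < yn.2)%N -> `|yn.1 i.+1 - yn.1 i| < eta])
  (fun e => let: ex_intro y (ex_intro n h) := chain e in ex_intro _ (y, n) h).
pose P e := walk eta M (yn e).1 (yn e).2.
have PP e : [/\ path grid_step (c (pos (hu e))) (P e), last (c (pos (hu e))) (P e) = c (pos (hv e)) &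
    forall q, q \in P e -> exists t z,
      [/\ 0 <= t <= 1, in_frame M z, `|z - F e t| < eta & q = c z]].
  have [y0 yl yF yst] := ynP e.
  have [|pk lk wk] := @walkP R eta M eta0 (yn e).1 (yn e).2 _ yst.
    by move=> i /yF[t t01 ->]; apply: frame_F.
  rewrite y0 yl in pk lk; split=> // q /wk[i [z [/yF[t t01 ->] frz zy qc]]].
  by exists t, z.
have Pq e q : q \in P e -> exists t z,
    [/\ 0 <= t <= 1, in_frame M z, `|z - F e t| < eta & q = c z].
  by have [_ _] := PP e; apply.
exists N, m, (c \o pos), P; split.
- by move=> u; have [a1 a2 a3 a4] := pos_itv u; rewrite /c /cell /= !m_lt // !cell_lt.
- move=> u v x; rewrite /= => xu xv.
  have /(near_dist eta0 (frame_pos u) (frame_pos v)) := grid_near_join xu xv.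
  have [-> //|uv] := eqVneq u v.
  have := he1 (u, v) uv; rewrite /= natrD mulrDl -/k -/kap => h1 h2.
  have : eps <= e1 by rewrite ge_min lexx.
  by move=> h3; exfalso; lra.
- by move=> e; have [? ? _] := PP e; split.
- move=> e x /Pq[t [z [t01 frz zF ->]]].
  have [b1 b2 b3 b4] := in_frameP frz.
  have := FM e t t01; rewrite prod_normE ge_max !ler_norml => /andP[/andP[? ?] /andP[? ?]].
  move: zF; rewrite norm_pair_lt !ltr_norml /= => /andP[/andP[? ?] /andP[? ?]].
  rewrite /c /cell /= !cell_gt0 ?(leq_ltn_trans (leq_addr _ _) (cell_lt _ b2)) //=; try lra.
  by rewrite (leq_ltn_trans (leq_addr _ _) (cell_lt _ b4)).
split.
- move=> e x w /Pq[t [z [t01 frz zF ->]]] nearw.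
  have dz := near_dist eta0 frz (frame_pos w) nearw.
  have [->|wu] := eqVneq w (hu e); first by left.
  have [->|wv] := eqVneq w (hv e); first by right.
  have := he2 (e, w) wu wv t t01; rewrite /= => h.
  have : eps <= e2 by rewrite ge_min lexx orbT.
  have := dist_tri3 (F e t) z z (pos w); rewrite subrr normr0 => h1 h2.
  by rewrite -/k -/kap in dz; exfalso; lra.
move=> e e' x ee /Pq[t [z [t01 frz zF ->]]].
move=> /Pq[t' [z' [t'01 frz' z'F zz']]].
apply/not_existsP => no.
have farw w : eps / 8 <= `|F e t - pos w|.
  have /negP/(far_dist eta0 frz (frame_pos w)) := no w; rewrite -/k -/kap.
  have := dist_tri3 z (F e t) (F e t) (pos w).
  rewrite subrr normr0 [`|F e t - z|]distrC; lra.
have := hd (e, e') ee t t' t01 t'01; rewrite /= F0 F1 => /(_ (farw _) (farw _)).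
have /(near_dist eta0 frz frz') : near 0 (cell eta M z) (cell eta M z').
  by rewrite -/c zz' grid_near_refl.
rewrite mul0r add0r => zz.
have := dist_tri3 (F e t) z z' (F e' t'); lra.
Qed.

End GridDrawing.

(** * Plane duals from drawings *)

Lemma edge_ends (G : sgraph) (e : {set G}) : e \in edges G ->
  exists xy : G * G, [/\ xy.1 != xy.2, sedge xy.1 xy.2 & e = [set xy.1; xy.2]].
Proof.
case/imsetP => -[x y] /= xy ->; exists (x, y); split=> //=.
by apply: contraTneq xy => /= ->; rewrite inE /= sedge_irrefl.
Qed.

Section PlanarCertificate.
Variables (R : realType) (H : sgraph) (pos : H -> R * R) (arc : {set H} -> R -> R * R).
Hypothesis draw : plane_drawing H pos arc.

Lemma drawing_ends (e : {set H}) : e \in edges H -> exists uv : H * H,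
  [/\ uv.1 != uv.2, e = [set uv.1; uv.2], arc e 0 = pos uv.1 & arc e 1 = pos uv.2].
Proof.
move=> eE; have ends := arc_ends draw eE.
have [u ue au] : (pos @` [set` e])%classic (arc e 0) by rewrite -ends; left.
have [v ve av] : (pos @` [set` e])%classic (arc e 1) by rewrite -ends; right.
have uv : u != v.
  apply/eqP => uv; have := arc_inj draw eE (x := 0) (y := 1).
  rewrite !in_itv /= !lexx ler01 -au -av uv => /(_ isT isT erefl)/eqP.
  by rewrite eq_sym oner_eq0.
exists (u, v) => /=; rewrite au av; split=> //.
apply/esym/eqP; rewrite eqEcard finset.subUset !finset.sub1set.
have [xy [nxy _ eE']] := edge_ends eE; rewrite cards2 uv {3}eE' cards2 nxy leqnn andbT.
by apply/andP.
Qed.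

Lemma drawing_certificate (u0 : H) :
  exists (E1 F1 : finType) (a1 b1 : E1 -> H) (l1 r1 : E1 -> F1),
  [/\ plane_dual a1 b1 l1 r1, forall e, a1 e != b1 e,
      forall e e', [set a1 e; b1 e] = [set a1 e'; b1 e'] -> e = e',
      forall u v, connect (adj a1 b1 [set: E1]) u v &
      inhabited F1 /\
      forall e, e \in edges H -> exists p, [set a1 p; b1 p] = e].
Proof.
pose W := {e : {set H} | e \in edges H}.
have [uv uvP] := @boolp.choice _ _ (fun (e : W) (uv : H * H) =>
   [/\ uv.1 != uv.2, val e = [set uv.1; uv.2], arc (val e) 0 = pos uv.1 & arc (val e) 1 = pos uv.2])
   (fun e => drawing_ends (valP e)).
pose hu e := (uv e).1; pose hv e := (uv e).2.
pose F (e : W) := arc (val e) \o @clamp R.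
have FE e t : 0 <= t <= 1 -> F e t = arc (val e) t by move=> t01; rewrite /F /= clamp_id.
have open_closed (t : R) : 0 < t < 1 -> 0 <= t <= 1 by move=> /andP[/ltW-> /ltW->].
have [||||||N [m [p [P [posN p_inj P_path P_range [P_avoid P_disj]]]]]] :=
  @grid_drawing R H W hu hv pos F.
- by move=> e; apply: clamp_continuous; apply: (arc_cont draw (valP e)).
- by move=> e; rewrite FE ?lexx ?ler01 //; have [] := uvP e.
- by move=> e; rewrite FE ?lexx ?ler01 //; have [] := uvP e.
- exact: pos_inj draw.
- move=> e t w t01; rewrite FE ?(open_closed _ t01) // => eq_tw.
  have : (arc (val e) @` `]0, 1[ `&` range pos)%classic (pos w).
    by split; [exists t; rewrite //= in_itv | exists w].
  by rewrite (arc_vertex draw (valP e)).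
- move=> e e' s t ee s01 t01; rewrite (FE e) ?(open_closed _ s01) // FE // => eq_st.
  have : (arc (val e) @` `]0, 1[ `&` arc (val e') @` `[0, 1])%classic (arc (val e') t).
    by split; [exists s; rewrite //= in_itv | exists t; rewrite //= in_itv].
  by rewrite (arc_disj draw (valP e) (valP e') ee).
have huv e : hu e != hv e by have [] := uvP e.
have [E1 [F1 [a1 [b1 [l1 [r1 [dual ll simp conn [inhF cover]]]]]]]] :=
  grid_certificate u0 huv posN p_inj (fun e => (P_path e).1) (fun e => (P_path e).2)
    P_range P_avoid P_disj.
exists E1, F1, a1, b1, l1, r1; split=> //; split=> // e eE.
have [q qP] := cover (exist _ e eE); exists q; rewrite qP.
by have [_ /= <-] := uvP (exist _ e eE).
Qed.

End PlanarCertificate.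

(** * Extended formulations *)

Section LinearForms.
Variables (R : realType) (d : nat) (M : finType).
Implicit Types f g : ('I_d -> R) -> (M -> R) -> R.

(** Constraints are written as functions of the variables; the coefficients, which a formulation in
    matrix form needs, are only asserted to exist. *)
Definition linear_form f := exists (cx : 'I_d -> R) (cy : M -> R), forall x y,
  f x y = \sum_k cx k * x k + \sum_m cy m * y m.

Lemma linear_form0 : linear_form (fun _ _ => 0).
Proof. by exists (fun=> 0), (fun=> 0) => x y; rewrite !big1 ?addr0 // => i _; rewrite mul0r. Qed.

Lemma linear_form_x k : linear_form (fun x _ => x k).
Proof.
exists (fun i => (i == k)%:R), (fun=> 0) => x y.
rewrite [X in _ + X]big1 ?addr0 => [|i _]; last by rewrite mul0r.
by rewrite (bigD1 k) //= eqxx mul1r big1 ?addr0 // => i /negbTE ->; rewrite mul0r.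
Qed.

Lemma linear_form_y m : linear_form (fun _ y => y m).
Proof.
exists (fun=> 0), (fun i => (i == m)%:R) => x y.
rewrite big1 ?add0r => [|i _]; last by rewrite mul0r.
by rewrite (bigD1 m) //= eqxx mul1r big1 ?addr0 // => i /negbTE ->; rewrite mul0r.
Qed.

Lemma linear_formD f g : linear_form f -> linear_form g ->
  linear_form (fun x y => f x y + g x y).
Proof.
move=> [fx [fy fE]] [gx [gy gE]]; exists (fun k => fx k + gx k), (fun m => fy m + gy m) => x y.
rewrite fE gE addrACA -!big_split /=; congr (_ + _); apply: eq_bigr => i _; exact: esym (mulrDl _ _ _).
Qed.

Lemma linear_formN f : linear_form f -> linear_form (fun x y => - f x y).
Proof.
move=> [fx [fy fE]]; exists (fun k => - fx k), (fun m => - fy m) => x y.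
by rewrite fE opprD -!sumrN; congr (_ + _); apply: eq_bigr => i _; rewrite mulNr.
Qed.

Lemma linear_form_sum (I : finType) (P : pred I) (f : I -> ('I_d -> R) -> (M -> R) -> R) :
  (forall i, linear_form (f i)) -> linear_form (fun x y => \sum_(i | P i) f i x y).
Proof.
move=> lf.
have [cx hx] := @boolp.choice _ _ (fun i cx => exists cy, forall x y, f i x y =
  \sum_k cx k * x k + \sum_m cy m * y m) lf.
have [cy hy] := boolp.choice hx.
exists (fun k => \sum_(i | P i) cx i k), (fun m => \sum_(i | P i) cy i m) => x y.
under eq_bigr do rewrite hy.
rewrite big_split /=; congr (_ + _); rewrite exchange_big /=; apply: eq_bigr => k _;
  by rewrite mulr_suml.
Qed.

End LinearForms.

Section ExtendedFormulations.
Variables (R : realType) (d : nat).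
Implicit Types P Q : set 'cV[R]_d.

Lemma system_formulation (I J M : finType) (f : I -> ('I_d -> R) -> (M -> R) -> R)
    (g : J -> ('I_d -> R) -> (M -> R) -> R) (beta : I -> R) (gamma : J -> R) :
  (forall i, linear_form (f i)) -> (forall j, linear_form (g j)) ->
  has_extended_formulation [set x : 'cV[R]_d | exists y : M -> R,
    (forall i, f i (x ^~ 0) y <= beta i) /\ (forall j, g j (x ^~ 0) y = gamma j)]%classic #|I|.
Proof.
move=> lf lg.
have [fx hx] := boolp.choice lf; have [fy hf] := boolp.choice hx.
have [gx hx'] := boolp.choice lg; have [gy hg] := boolp.choice hx'.
exists #|M|, #|J|, (\matrix_(i, k) fx (enum_val i) k), (\matrix_(i, m) fy (enum_val i) (enum_val m)),
  (\col_i beta (enum_val i)), (\matrix_(j, k) gx (enum_val j) k),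
  (\matrix_(j, m) gy (enum_val j) (enum_val m)), (\col_j gamma (enum_val j)).
have row_f x (y : 'cV_#|M|) i : ((\matrix_(i, k) fx (enum_val i) k) *m x +
    (\matrix_(i, m) fy (enum_val i) (enum_val m)) *m y) i 0 =
    f (enum_val i) (x ^~ 0) (fun m => y (enum_rank m) 0).
  rewrite hf !mxE; congr (_ + _); first by apply: eq_bigr => k _; rewrite mxE.
  rewrite [RHS](reindex_omap (enum_val (A := M)) (Some \o enum_rank)) //=; last first.
    by move=> m _; rewrite enum_rankK.
  by apply: eq_big => m; rewrite ?enum_valK ?eqxx // mxE.
have row_g x (y : 'cV_#|M|) i : ((\matrix_(i, k) gx (enum_val i) k) *m x +
    (\matrix_(i, m) gy (enum_val i) (enum_val m)) *m y) i 0 =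
    g (enum_val i) (x ^~ 0) (fun m => y (enum_rank m) 0).
  rewrite hg !mxE; congr (_ + _); first by apply: eq_bigr => k _; rewrite mxE.
  rewrite [RHS](reindex_omap (enum_val (A := M)) (Some \o enum_rank)) //=; last first.
    by move=> m _; rewrite enum_rankK.
  by apply: eq_big => m; rewrite ?enum_valK ?eqxx // mxE.
apply/seteqP; split=> x /= [y [yf yg]].
  have yE : (fun m => (\col_i y (enum_val i)) (enum_rank m) 0) = y.
    by apply/funext => m; rewrite mxE enum_rankK.
  exists (\col_i y (enum_val i)); split=> [i|]; first by rewrite row_f yE mxE.
  by apply/matrixP => j k; rewrite !ord1 row_g yE mxE.
exists (fun m => y (enum_rank m) 0); split=> [i|j].
  by have := yf (enum_rank i); rewrite row_f mxE enum_rankK.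
have := congr1 (fun N : 'cV_ _ => N (enum_rank j) 0) yg.
by rewrite row_g mxE enum_rankK.
Qed.

Lemma formulation_setT : has_extended_formulation [set: 'cV[R]_d]%classic 0.
Proof.
have := @system_formulation void void void (fun=> fun _ _ => 0) (fun=> fun _ _ => 0)
  (fun=> 0) (fun=> 0) (fun=> linear_form0 _ _ _) (fun=> linear_form0 _ _ _).
rewrite card_void; congr has_extended_formulation; apply/seteqP; split=> // x _ /=.
Qed.

Lemma formulation_setI P Q r s : has_extended_formulation P r ->
  has_extended_formulation Q s -> has_extended_formulation (P `&` Q)%classic (r + s).
Proof.
move=> [m1 [q1 [A1 [B1 [b1 [C1 [D1 [c1 ->]]]]]]]] [m2 [q2 [A2 [B2 [b2 [C2 [D2 [c2 ->]]]]]]]].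
exists (m1 + m2)%N, (q1 + q2)%N, (col_mx A1 A2), (block_mx B1 0 0 B2), (col_mx b1 b2),
  (col_mx C1 C2), (block_mx D1 0 0 D2), (col_mx c1 c2).
have split_row (k1 k2 : nat) (A : 'M[R]_(k1, d)) A' (B : 'M[R]_(k1, m1)) (B' : 'M[R]_(k2, m2)) x y1 y2 :
    col_mx A A' *m x + block_mx B 0 0 B' *m col_mx y1 y2 =
    col_mx (A *m x + B *m y1) (A' *m x + B' *m y2) :> 'cV_ _.
  by rewrite mul_col_mx mul_block_col !mul0mx addr0 add0r add_col_mx.
apply/seteqP; split=> x /=.
  move=> [[y1 [le1 eq1]] [y2 [le2 eq2]]]; exists (col_mx y1 y2); rewrite !split_row.
  split=> [i|]; last by rewrite eq1 eq2.
  by case: (split_ordP i) => j ->; rewrite ?col_mxEu ?col_mxEd.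
move=> [y]; rewrite -(vsubmxK y) !split_row => -[le_y /eq_col_mx[eq1 eq2]].
split; [exists (usubmx y) | exists (dsubmx y)]; split=> // i.
  by have := le_y (lshift _ i); rewrite !col_mxEu.
by have := le_y (rshift _ i); rewrite !col_mxEd.
Qed.

Lemma formulation_forall (T : eqType) (s : seq T) (P : T -> set 'cV[R]_d) r :
  (forall t, has_extended_formulation (P t) r) ->
  has_extended_formulation [set x | forall t, t \in s -> P t x]%classic (size s * r).
Proof.
move=> hP; elim: s => [|t s IH].
  rewrite mul0n (_ : mkset _ = [set: _]%classic); first exact: formulation_setT.
  by apply/seteqP; split.
rewrite /= mulSn (_ : mkset _ = (P t `&` [set x | forall t, t \in s -> P t x])%classic).
  exact: formulation_setI.
apply/seteqP; split=> x /= => [h|[Pt h] u].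
  by split=> [|u us]; apply: h; rewrite inE ?eqxx // us orbT.
by rewrite inE => /orP[/eqP ->|/h].
Qed.

Lemma formulation_convex P r : has_extended_formulation P r ->
  @convex_set R (convex_lmodType 'cV[R]_d) P.
Proof.
move=> [m [q [A [B [b [C [D [c ->]]]]]]]] x x' t.
rewrite !in_setE /= => -[y [le_y eq_y]] [y' [le_y' eq_y']].
have t0 : 0 <= t%:num by []; have t1 : 0 <= 1 - t%:num by rewrite subr_ge0.
exists (t%:num *: y + (1 - t%:num) *: y').
have E (k : nat) (N : 'M[R]_(k, d)) (N' : 'M[R]_(k, m)) :
    N *m (t%:num *: x + (1 - t%:num) *: x') + N' *m (t%:num *: y + (1 - t%:num) *: y') =
    t%:num *: (N *m x + N' *m y) + (1 - t%:num) *: (N *m x' + N' *m y').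
  by rewrite !mulmxDr -!scalemxAr addrACA -!scalerDr.
split=> [i|].
  have -> : b i 0 = t%:num * b i 0 + (1 - t%:num) * b i 0 by ring.
  have := E _ A B => /(congr1 (fun N : 'cV_ _ => N i 0)) => ->.
  by rewrite !mxE lerD // ler_wpM2l //; [have := le_y i | have := le_y' i]; rewrite !mxE.
have := E _ C D; rewrite eq_y eq_y' -scalerDl [_ + (1 - _)]addrC subrK scale1r => <-.
by [].
Qed.

Lemma xc_le P r : has_extended_formulation P r -> (xc P <= r%:R%:E)%E.
Proof. by move=> h; apply: ereal_inf_lbound; exists r. Qed.

End ExtendedFormulations.

(** * Spanning trees of simple graphs *)

Section SpanningTrees.
Variables (G : sgraph) (a b : 'I_#|edges G| -> G).
Hypothesis ends_neq : forall i, a i != b i.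
Hypothesis endsE : forall i, enum_val i = [set a i; b i].
Hypothesis G_connected : is_connected G.
Let E := 'I_#|edges G|.

Lemma ends_inj i j : [set a i; b i] = [set a j; b j] -> i = j.
Proof. by rewrite -!endsE => /enum_val_inj. Qed.

Lemma adj_joined (T : {set {set G}}) x y : T \subset edges G ->
  adj a b [set i | enum_val i \in T] x y = joined T x y.
Proof.
move=> TE; apply/exists_inP/andP => [[i]|[xy xyT]].
  rewrite inE endsE => iT /orP[]/andP[/eqP <- /eqP <-]; split=> //.
    by rewrite eq_sym ends_neq.
  by rewrite setUC.
have xyE := subsetP TE _ xyT; exists (enum_rank_in xyE [set x; y]).
  by rewrite inE enum_rankK_in.
have /setP eqs := endsE (enum_rank_in xyE [set x; y]); rewrite enum_rankK_in // in eqs.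
have := eqs x; have := eqs y; rewrite !inE !eqxx orbT /= => /esym/orP[]/eqP hy /esym/orP[]/eqP hx.
- by case/eqP: xy; exact: etrans hx (esym hy).
- by rewrite -hx -hy !eqxx orbT.
- by rewrite -hx -hy !eqxx.
- by case/eqP: xy; exact: etrans hx (esym hy).
Qed.

Lemma graph_connected u v : connect (adj a b [set: E]) u v.
Proof.
have -> : [set: E] = [set i | enum_val i \in edges G].
  by apply/setP => i; rewrite !inE enum_valP.
apply: (connect_sub _ (G_connected u v)) => x y xy; apply: connect1.
rewrite adj_joined // /joined /=; apply/andP; split.
  by apply: contraTneq xy => ->; rewrite sedge_irrefl.
by apply/imsetP; exists (x, y).
Qed.

(** If a chain on [K] were a cycle through [e], the ends of [e] would be connected in [K :\ e], and a
    simple path between them would close up with [e] to a cycle of the graph. *)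
Lemma spanning_tree_indep T : spanning_tree T -> let K := [set i : E | enum_val i \in T] in
  indep a b set0 K /\ forall u v, connect (adj a b K) u v.
Proof.
move=> [TE conn acyc] K; have adjK x y : adj a b K x y = joined T x y by exact: adj_joined.
split; last by move=> u v; rewrite (eq_connect adjK).
move=> z zK bz e; apply/eqP/negPn/negP => ze.
have /connectP[p0 /shortenP[p pp up _] lp] :=
  cycle_edge_connect zK (fun v => bz v (negbT (in_set0 v))) ze.
have eK : e \in K by apply: contraNT ze => /zK ->.
apply: (acyc (a e :: p)); last first.
  rewrite /ucycle up andbT /= rcons_path -lp -!adjK; apply/andP; split.
    apply: sub_path pp => x y; rewrite -adjK => /exists_inP[i]; rewrite !inE => /andP[_ iK] h.
    by apply/exists_inP; exists i; rewrite // inE.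
  by rewrite adj_sym; apply: adj_edge.
case: p pp lp {up} => [|w [|//]] /= pp lp.
  by have := ends_neq e; rewrite lp eqxx.
move: pp; rewrite -lp andbT => /exists_inP[i]; rewrite !inE => /andP[ie _] h.
case/eqP: ie; apply: ends_inj; case/orP: h => /andP[/eqP -> /eqP ->] //.
by rewrite setUC.
Qed.

(** A cycle of the graph minus its closing edge [e] is a path, whose chain together with [e] has zero
    boundary. *)
Lemma indep_spanning_tree K : indep a b set0 K -> (forall u v, connect (adj a b K) u v) ->
  let T := [set enum_val i | i in K] in
  spanning_tree T /\ forall i : E, (enum_val i \in T) = (i \in K).
Proof.
move=> iK conn T.
have memT i : (enum_val i \in T) = (i \in K) by rewrite mem_imset //; exact: enum_val_inj.
have TE : T \subset edges G by apply/subsetP => e /imsetP[i _ ->]; exact: enum_valP.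
have KE : K = [set i | enum_val i \in T] by apply/setP => i; rewrite inE memT.
have adjK x y : adj a b K x y = joined T x y by rewrite KE adj_joined.
split=> //; split=> // [x y|]; first by rewrite -(eq_connect adjK).
case=> [|x [|w [|y s]]] //= _ /andP[].
rewrite /= rcons_path => /and3P[xw wy /andP[ps lx]] /and3P[xN wN uys].
set z := last y s in lx.
have zys : z \in y :: s by exact: mem_last.
have xz : x != z.
  by apply: contraNneq xN => ->; rewrite inE zys orbT.
have wz : w != z by apply: contraNneq wN => ->.
move: lx; rewrite -adjK => /exists_inP[e eK e_zx].
have avoid u v : (u != x) && (v != x) || (u == x) && (v == w) -> adj a b K u v ->
    adj a b (K :\ e) u v.
  move=> uv /exists_inP[i iK' h]; apply/exists_inP; exists i => //.
  rewrite !inE iK' andbT; apply/eqP => ie; rewrite ie in h.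
  move: uv h e_zx; case: (eqVneq u x) => [->|ux] /=; rewrite ?orbF.
    move=> /eqP ->; case/orP => /andP[/eqP -> /eqP ->]; rewrite eqxx /=.
      by rewrite (negbTE wz) (negbTE xz) ?andbF.
    by rewrite (negbTE wz) (negbTE xz) ?andbF.
  move=> vx; case/orP => /andP[/eqP -> /eqP ->];
    by rewrite (negbTE ux) (negbTE vx) ?andbF.
have cxz : connect (adj a b (K :\ e)) x z.
  apply: (connect_trans (y := w)); first by apply/connect1/avoid; rewrite ?adjK // !eqxx orbT.
  apply/connectP; exists (y :: s) => //.
  have : all (predC1 x) [:: w, y & s].
    apply/allP => t ts; apply: contraNneq xN => <-; exact: ts.
  have : path (joined T) w (y :: s) by rewrite /= wy.
  move=> /[swap]; elim: (y :: s) (w) => //= t r IH u /andP[ux /[dup] allr /andP[tx _]] /andP[ut pr].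
  by rewrite IH // andbT avoid ?adjK //= ux tx.
have [pi piK bpi] := connect_chain cxz.
have e0 := iK (fun i => pi i + (i == e)%:R) _ _ e; move: e0.
rewrite piK ?inE ?eqxx // add0r => e0.
suff : (1 : 'F_2) = 0 by move/eqP; rewrite oner_eq0.
apply: e0 => [i iK'|v _].
  rewrite piK ?inE ?(negbTE iK') ?andbF // add0r.
  by have [ie|//] := eqVneq i e; rewrite ie eK in iK'.
rewrite bdD bpi bd_delta.
case/orP: e_zx => /andP[/eqP -> /eqP ->]; last by rewrite addF2.
by rewrite [(z == v)%:R + _]addrC addF2.
Qed.

Lemma tree_card (K : {set E}) : indep a b set0 K -> (forall u v, connect (adj a b K) u v) ->
  #|K| = #|G|.-1.
Proof.
move=> iK conn; have [r _|noG] := pickP (@predT G); last first.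
  have G0 : #|G| = 0%N by apply: eq_card0.
  rewrite G0; apply: eq_card0 => i; have := noG (a i); by [].
have toR x : exists2 u, u \in [set r] & connect (adj a b K) x u by exists r; rewrite ?inE.
have [pa [pb [pK outp]]] := tree_parents (indep_root iK) toR.
transitivity (\sum_i (i \in K : nat))%N; first by rewrite -big_mkcond sum1_card.
under eq_bigr do rewrite -pK.
rewrite -(sum_out a b pa pb); under eq_bigr do rewrite outp.
by rewrite sum_notin cardsC1.
Qed.

(** Each vertex but a root has its own parent edge. *)
Lemma connected_edge_bound : (#|G|.-1 <= #|edges G|)%N.
Proof.
have [r _|noG] := pickP (@predT G); last by rewrite [#|G|](eq_card0 noG).
have toR x : exists2 u, u \in [set r] & connect (adj a b [set: E]) x u.
  by exists r; rewrite ?inE //; exact: graph_connected.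
have [pa [pb [pK outp]]] := parents toR.
rewrite -(cardsC1 r) -sum_notin; under eq_bigr do rewrite -outp.
rewrite sum_out; apply: (@leq_trans (\sum_(e : E) 1)%N); last by rewrite sum1_card card_ord.
apply: leq_sum => e _.
by apply: leq_trans (pK e) _; case: (_ \in _).
Qed.

End SpanningTrees.

(** * The formulations of Martin and Williams *)

Section Formulations.
Variables (R : realType) (d : nat).

Lemma linear_form_out (V E M : finType) (a b : E -> V) (pa pb : E -> M) v :
  linear_form (fun (_ : 'I_d -> R) y => out a b (y \o pa) (y \o pb) v).
Proof.
by apply: linear_formD; apply: linear_form_sum => e; apply: linear_form_y.
Qed.

Lemma base_formulation (n : R) : has_extended_formulation
  [set x : 'cV[R]_d | (forall i, 0 <= x i 0) /\ \sum_i x i 0 = n]%classic d.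
Proof.
have lf (i : 'I_d) : linear_form (fun x (_ : void -> R) => - x i).
  exact/linear_formN/linear_form_x.
have lg (_ : unit) : linear_form (fun (x : 'I_d -> R) (_ : void -> R) => \sum_i x i).
  by apply: linear_form_sum => i; apply: linear_form_x.
have := system_formulation (fun=> 0) (fun=> n) lf lg.
rewrite card_ord; congr has_extended_formulation.
apply/seteqP; split=> x /= [] => [y [x0 xn]|x0 xn].
  by split=> [i|]; [rewrite -oppr_le0 | exact: (xn tt)].
exists (fun=> 0); split=> // i; by rewrite oppr_le0.
Qed.

Definition martin_set (V : finType) (a b : 'I_d -> V) (rt : V) : set 'cV[R]_d :=
  [set x | exists pa pb : 'I_d -> R, [/\ forall e, 0 <= pa e, forall e, 0 <= pb e,
     forall e, x e 0 <= pa e + pb e & forall v, out a b pa pb v = (v != rt)%:R]]%classic.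

Lemma martin_formulation (V : finType) (a b : 'I_d -> V) (rt : V) :
  has_extended_formulation (martin_set a b rt) (3 * d).
Proof.
pose f (i : 'I_d + 'I_d + 'I_d) (x : 'I_d -> R) (y : 'I_d + 'I_d -> R) : R :=
  match i with inl m => - y m | inr e => x e - (y (inl e) + y (inr e)) end.
have lf i : linear_form (f i).
  case: i => [m|e]; first exact/linear_formN/linear_form_y.
  apply: linear_formD; first exact: linear_form_x.
  by apply: linear_formN; apply: linear_formD; apply: linear_form_y.
have := system_formulation (fun=> 0) (fun v => (v != rt)%:R) lf
  (fun v : V => linear_form_out a b inl inr v).
rewrite !card_sum card_ord (_ : d + d + d = 3 * d)%N; last by lia.
congr has_extended_formulation; apply/seteqP; split=> x /= [].
  move=> y [fy oy]; exists (y \o inl), (y \o inr); split=> // e.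
  - by have := fy (inl (inl e)); rewrite /= oppr_le0.
  - by have := fy (inl (inr e)); rewrite /= oppr_le0.
  - by have := fy (inr e); rewrite /= subr_le0.
move=> pa [pb [pa0 pb0 xp outp]].
exists (fun m => match m with inl e => pa e | inr e => pb e end); split=> //.
by case=> [[e|e]|e] /=; rewrite ?oppr_le0 ?subr_le0.
Qed.

Definition williams_set (V E F : finType) (a b : E -> V) (l r : E -> F) (rt : V) (f0 : F)
    (tau : 'I_d -> option E) : set 'cV[R]_d :=
  [set x | exists pa pb dl dr : E -> R,
    [/\ forall e, [/\ 0 <= pa e, 0 <= pb e, 0 <= dl e & 0 <= dr e],
        forall e, pa e + pb e + (dl e + dr e) <= 1,
        forall v, out a b pa pb v = (v != rt)%:R,
        forall f, out l r dl dr f = (f != f0)%:R &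
        forall i e, tau i = Some e -> x i 0 <= pa e + pb e]]%classic.

Lemma williams_formulation (V E F : finType) (a b : E -> V) (l r : E -> F) (rt : V) (f0 : F)
    (tau : 'I_d -> option E) :
  has_extended_formulation (williams_set a b l r rt f0 tau) (5 * #|E| + d).
Proof.
pose M : finType := (E + E + (E + E))%type.
pose f (i : M + E + 'I_d) (x : 'I_d -> R) (y : M -> R) : R :=
  match i with
  | inl (inl m) => - y m
  | inl (inr e) => y (inl (inl e)) + y (inl (inr e)) + (y (inr (inl e)) + y (inr (inr e)))
  | inr i => if tau i is Some e then x i - (y (inl (inl e)) + y (inl (inr e))) else 0
  end.
have lf i : linear_form (f i).
  case: i => [[m|e]|i].
  - exact/linear_formN/linear_form_y.
  - by apply: linear_formD; apply: linear_formD; apply: linear_form_y.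
  rewrite /f; case: (tau i) => [e|]; last exact: linear_form0.
  apply: linear_formD; first exact: linear_form_x.
  by apply: linear_formN; apply: linear_formD; apply: linear_form_y.
pose g (j : V + F) (x : 'I_d -> R) (y : M -> R) : R :=
  match j with
  | inl v => out a b (y \o (inl \o inl)) (y \o (inl \o inr)) v
  | inr h => out l r (y \o (inr \o inl)) (y \o (inr \o inr)) h
  end.
have lg j : linear_form (g j).
  by case: j => [v|h]; apply: linear_form_out.
have := system_formulation (fun i => if i is inl (inr _) then 1 else 0)
  (fun j => match j with inl v => (v != rt)%:R | inr h => (h != f0)%:R end) lf lg.
rewrite !card_sum card_ord (_ : _ + d = 5 * #|E| + d)%N; last by lia.
congr has_extended_formulation; apply/seteqP; split=> x /= [].
  move=> y [fy gy]; exists (y \o (inl \o inl)), (y \o (inl \o inr)), (y \o (inr \o inl)), (y \o (inr \o inr)).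
  split.
  - move=> e; have y0 m : 0 <= y m by have := fy (inl (inl m)); rewrite /= oppr_le0.
    by split; apply: y0.
  - by move=> e; have := fy (inl (inr e)).
  - by move=> v; have := gy (inl v).
  - by move=> h; have := gy (inr h).
  by move=> i e ie; have := fy (inr i); rewrite /= ie subr_le0.
move=> pa [pb [dl [dr [ge0 cap outp outd xp]]]].
exists (fun m : M => match m with inl (inl e) => pa e | inl (inr e) => pb e
  | inr (inl e) => dl e | inr (inr e) => dr e end); split.
  case=> [[[[e|e]|[e|e]]|e]|i] /=; rewrite ?oppr_le0 //; try by have [] := ge0 e.
  by case ie: (tau i) => [e|//]; rewrite subr_le0; apply: xp.
by case=> [v|h] /=; [rewrite -outp | rewrite -outd].
Qed.

End Formulations.

Lemma sum_partial_inj (R : realFieldType) (I J : finType) (A : {set I}) (B : {set J})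
    (tau : I -> option J) (g : J -> R) :
  (forall p, 0 <= g p) -> (forall i, i \in A -> exists2 p, p \in B & tau i = Some p) ->
  {in A &, injective tau} ->
  \sum_(i in A) (if tau i is Some p then g p else 0) <= \sum_(p in B) g p.
Proof.
move=> g0 AB inj; pose g' o : R := if o is Some p then g p else 0.
rewrite -(big_imset g' inj) /=.
have <- : \sum_(o in Some @: B) g' o = \sum_(p in B) g p.
  by rewrite big_imset //= => x y _ _ [].
rewrite big_mkcond [leRHS]big_mkcond; apply: ler_sum => o _.
case: ifP => [/imsetP[i /AB[p pB ->] ->]|_]; first by rewrite imset_f.
by case: ifP => // _; case: o => /=.
Qed.

Lemma out_natr (R : realFieldType) (V E : finType) (a b : E -> V) (pa pb : E -> nat) v :
  out a b (fun e => (pa e)%:R : R) (fun e => (pb e)%:R) v = (out a b pa pb v)%:R.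
Proof. by rewrite /out natrD !natr_sum. Qed.

Section PlanePart.
Variables (R : realType) (G : sgraph) (a b : 'I_#|edges G| -> G) (X : {set G}).
Hypothesis ends_edge : forall i, sedge (a i) (b i).
Hypothesis endsE : forall i, enum_val i = [set a i; b i].
Let H := del_vertices X.
Hypothesis H_planar : planar R H.

Let ends_inj := ends_inj endsE.

(** Williams' formulation for the connected plane graph that contains [H], where [tau] locates the edges
    of [G] outside [X].  Its feasible points satisfy the bounds for all [S] outside [X], and the characteristic
    vectors of forests of [G] are feasible.  If [X] contains all vertices, no inequality is needed. *)
Lemma plane_formulation : exists (s : nat) (W : set 'cV[R]_#|edges G|),
  [/\ has_extended_formulation W s /\ (s <= 5 * (3 * #|G|.-1) + #|edges G|)%N,
      (#|[set i | (a i \notin X) && (b i \notin X)]| <= 3 * #|G|.-1)%N,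
      forall x (S : {set G}) u, W x -> u \in S -> (forall v, v \in S -> v \notin X) ->
        \sum_(i in inside a b S) x i 0 <= #|S|%:R - 1 &
      forall K : {set _}, indep a b set0 K -> W (\col_i (i \in K)%:R)].
Proof.
have [v0 _|noH] := pickP (@predT H); last first.
  have allX v : v \in X by apply/negPn/negP => vX; have := noH (exist _ v vX).
  exists 0%N, [set: 'cV[R]_#|edges G|]%classic; split=> //.
  - by split; first exact: formulation_setT.
  - by rewrite (_ : [set _ | _] = set0) ?cards0 //; apply/setP => i; rewrite !inE !allX.
  by move=> x S u _ uS /(_ u uS); rewrite allX.
have [pos [arc draw]] := H_planar.
have [E1 [F1 [a1 [b1 [l1 [r1 [dual ll simp conn [[f1] cover]]]]]]]] :=
  drawing_certificate draw v0.
have cardH : (#|H|.-1 <= #|G|.-1)%N.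
  have -> : #|H| = #|[pred x | x \notin X]| by rewrite -(card_sig (fun x => x \notin X)).
  by rewrite -!subn1 leq_sub2r // max_card.
have cardE1 : (#|E1| <= 3 * #|G|.-1)%N.
  apply: leq_trans (planar_edge_bound dual ll simp v0) _.
  by rewrite leq_mul2l cardH orbT.
pose ok i (o : option E1) := match o with
  | Some p => [set val (a1 p); val (b1 p)] = [set a i; b i]
  | None => (a i \in X) || (b i \in X) end.
have [tau tauP] : exists tau, forall i, ok i (tau i).
  suff h i : exists o, ok i o by have [tau ?] := boolp.choice h; exists tau.
  have [aX|aX] := boolP (a i \in X); first by exists None; rewrite /= aX.
  have [bX|bX] := boolP (b i \in X); first by exists None; rewrite /= bX orbT.
  pose ha : H := exist _ (a i) aX; pose hb : H := exist _ (b i) bX.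
  have [|p pE] := cover [set ha; hb].
    by apply/imsetP; exists (ha, hb); rewrite // inE /= ends_edge.
  exists (Some p) => /=.
  by have := congr1 (fun S : {set H} => val @: S) pE; rewrite !imsetU1 !imset_set1.
have tau_inj i j p : tau i = Some p -> tau j = Some p -> i = j.
  move=> ti tj; apply: ends_inj; have := tauP i; have := tauP j.
  by rewrite ti tj /= => -> ->.
have someI : injective (@Some E1) by move=> p q [].
have tau_some i : a i \notin X -> b i \notin X -> exists p, tau i = Some p.
  move=> aX bX; have := tauP i; case: (tau i) => [p _|/=]; first by exists p.
  by rewrite (negbTE aX) (negbTE bX).
have [f0 f0P] : exists f0, forall v, v != v0 -> exists2 e, at_vertex a1 b1 v0 e & l1 e = f0.
  have [[e ev]|no] := pselect (exists e, at_vertex a1 b1 v0 e).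
    by exists (l1 e) => v _; exists e.
  exists f1 => v vv0; case: no; have /connectP[[|w s] /=] := conn v0 v.
    by move=> _ vE; rewrite vE eqxx in vv0.
  move=> /andP[/exists_inP[e _ h] _] _; exists e; rewrite /at_vertex.
  by case/orP: h => /andP[/eqP -> /eqP ->]; rewrite eqxx ?orbT.
exists (5 * #|E1| + #|edges G|)%N, (williams_set a1 b1 l1 r1 v0 f0 tau); split.
- by split; [exact: williams_formulation | rewrite leq_add2r leq_mul2l cardE1 orbT].
- apply: leq_trans cardE1; rewrite -(card_in_imset (f := tau)); last first.
    move=> i j; rewrite !inE => /andP[aX bX] _ eqt; have [p ip] := tau_some _ aX bX.
    by apply: (tau_inj i j p) => //; rewrite -eqt.
  rewrite -cardsT -(card_imset _ someI); apply/subset_leq_card/subsetP => o.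
  move=> /imsetP[i]; rewrite inE => /andP[aX bX] ->.
  by have [p ->] := tau_some _ aX bX; apply: imset_f; rewrite inE.
- move=> x S u [pa [pb [dl [dr [ge0 cap outp outd xp]]]]] uS SX.
  pose S' := [set v : H | val v \in S].
  have SE : S = val @: S'.
    apply/setP => v; apply/idP/imsetP => [vS|[w + ->]]; last by rewrite inE.
    by exists (exist _ v (SX v vS)); rewrite ?inE.
  have uS' : (exist _ u (SX u uS) : H) \in S' by rewrite inE.
  have cardS : #|S| = #|S'| by rewrite {1}SE card_imset //; exact: val_inj.
  have key i : i \in inside a b S -> exists2 p, p \in inside a1 b1 S' & tau i = Some p.
    rewrite inE => /andP[aS bS]; have [p ip] := tau_some _ (SX _ aS) (SX _ bS).
    exists p => //; have := tauP i; rewrite ip /= => /setP eqs; rewrite !inE.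
    have sub v : v \in [set a i; b i] -> v \in S by rewrite !inE => /orP[]/eqP ->.
    by apply/andP; split; apply: sub; rewrite -eqs !inE eqxx ?orbT.
  rewrite cardS; apply: le_trans (williams_sound dual f0P ge0 cap outp outd uS').
  apply: le_trans (sum_partial_inj (tau := tau) (g := fun e => pa e + pb e) _ key _).
  + apply: ler_sum => i /key[p _ ip]; rewrite ip; exact: xp.
  + by move=> p; have [? ? _ _] := ge0 p; apply: addr_ge0.
  by move=> i j /key[p _ ip] /key[q _ iq] eqt; apply: (tau_inj i j p) => //; rewrite -eqt.
move=> K iK; pose K0 := [set p | [exists i in K, tau i == Some p]].
have iK0 : indep a1 b1 set0 K0.
  move=> z zK0 bz.
  pose z' i := if tau i is Some p then z p else 0.
  have z'K : supported K z'.
    move=> i iNK; rewrite /z'; case ti: (tau i) => [p|//]; apply: zK0.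
    rewrite inE; apply/exists_inP => -[j jK /eqP tj].
    by rewrite (tau_inj _ _ _ ti tj) jK in iNK.
  have z'0 : forall i, z' i = 0.
    apply: iK z'K _ => v _.
    pose h p : 'F_2 := z p * ((val (a1 p) == v)%:R + (val (b1 p) == v)%:R).
    transitivity (\sum_p h p).
      transitivity (\sum_i \sum_(p | tau i == Some p) h p).
        apply: eq_bigr => i _; rewrite /z'; have := tauP i; case: (tau i) => [p|_]; last first.
          by rewrite mul0r big_pred0.
        move=> /= eqs; rewrite (big_pred1 p) => [|q]; last by rewrite (inj_eq someI) eq_sym.
        rewrite /h; congr (_ * _).
        have orE (s t : G) : s != t -> (s == v)%:R + (t == v)%:R = (v \in [set s; t])%:R :> 'F_2.
          move=> st; rewrite F2_natr_addb !inE ![v == _]eq_sym; congr (_ : bool)%:R.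
          by have [<-|//] := eqVneq s v; rewrite eq_sym (negbTE st).
        rewrite !orE ?eqs //; last first.
          by apply: contraTneq (ends_edge i) => ->; rewrite sedge_irrefl.
        by rewrite (inj_eq val_inj) ll.
      rewrite (exchange_big_dep xpredT) //=; apply: eq_bigr => p _.
      have [z0|zp] := eqVneq (z p) 0.
        by rewrite big1 => [|i _]; rewrite /h z0 mul0r.
      have : p \in K0 by apply: contraNT zp => /zK0 ->.
      rewrite inE => /exists_inP[i _ /eqP ti]; rewrite (big_pred1 i) // => j.
      by apply/eqP/eqP => [tj|->//]; apply: tau_inj tj ti.
    have [vX|vX] := boolP (v \in X).
      apply: big1 => p _; rewrite /h.
      have nv (w : H) : (val w == v) = false.
        by apply: contraTF vX => /eqP <-; exact: valP w.
      by rewrite !nv addr0 mulr0.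
    rewrite -[RHS](bz (exist _ v vX)) ?inE //; apply: eq_bigr => p _; congr (_ * (_ + _)).
  move=> p; have [pK|/zK0 //] := boolP (p \in K0).
  move: pK; rewrite inE => /exists_inP[i _ /eqP ti].
  by have := z'0 i; rewrite /z' ti.
have [pa [pb [dl [dr [K0p cap outp outd]]]]] := williams_complete dual v0 f0 iK0 conn.
exists (fun e => (pa e)%:R), (fun e => (pb e)%:R), (fun e => (dl e)%:R), (fun e => (dr e)%:R).
split=> [e|e|v|f|i e ti].
- by split; apply: ler0n.
- by rewrite -!natrD (ler_nat R _ 1).
- by rewrite out_natr outp.
- by rewrite out_natr outd.
rewrite mxE -natrD ler_nat; case: (boolP (i \in K)) => // iK'.
by apply: leq_trans (K0p e); rewrite inE lt0b; apply/exists_inP; exists i; rewrite // ti.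
Qed.

End PlanePart.

(** * Apex graphs *)

Section ApexBounds.
Variables (R : realType) (G : sgraph) (X : {set G}).
Hypothesis G_connected : is_connected G.
Hypothesis H_planar : planar R (del_vertices X).

Lemma oriented_ends : exists a b : 'I_#|edges G| -> G,
  [/\ forall i, a i != b i, forall i, sedge (a i) (b i) &
      forall i, enum_val i = [set a i; b i]].
Proof.
have [ends endsP] := boolp.choice (fun i : 'I_#|edges G| => edge_ends (enum_valP i)).
by exists (fun i => (ends i).1), (fun i => (ends i).2); split=> i; have [] := endsP i.
Qed.

(** An edge meets [X] or belongs to the planar part. *)
Lemma apex_edge_bound : (#|edges G| <= #|X| * #|G| + 3 * #|G|.-1)%N.
Proof.
have [a [b [ab ends_edge endsE]]] := oriented_ends.
have [s [W [_ cardH _ _]]] := plane_formulation ends_edge endsE H_planar.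
pose inH := [set i | (a i \notin X) && (b i \notin X)].
rewrite -[leqLHS]card_ord -(cardsC inH) addnC; apply: leq_add; last exact: cardH.
apply: leq_trans (_ : #|(fun xy : G * G => [set xy.1; xy.2]) @: setX X [set: G]| <= _)%N.
  rewrite -(card_imset (~: inH) enum_val_inj); apply/subset_leq_card/subsetP => e.
  move=> /imsetP[i]; rewrite !inE negb_and !negbK endsE => /orP[aX|bX] ->.
    by apply/imsetP; exists (a i, b i); rewrite // inE /= aX inE.
  by apply/imsetP; exists (b i, a i); rewrite ?inE /= ?bX ?inE // setUC.
by apply: leq_trans (leq_imset_card _ _) _; rewrite cardsX cardsT.
Qed.

Lemma apex_formulation : exists2 s : nat,
  has_extended_formulation (sp_trees_polytope R G) s & (s <= (17 + 3 * #|X|) * #|edges G|)%N.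
Proof.
have [a [b [ab ends_edge endsE]]] := oriented_ends.
have [s [W [[Wext sle] _ Wsound Wtree]]] := plane_formulation ends_edge endsE H_planar.
pose base := [set x : 'cV[R]_#|edges G| | (forall i, 0 <= x i 0) /\ \sum_i x i 0 = #|G|.-1%:R]%classic.
pose martin := [set x : 'cV[R]_#|edges G| | forall r, r \in enum X -> martin_set a b r x]%classic.
have ext : has_extended_formulation (base `&` (martin `&` W))%classic
    (#|edges G| + (size (enum X) * (3 * #|edges G|) + s)).
  apply: formulation_setI; first exact: base_formulation.
  apply: formulation_setI => //; apply: formulation_forall => r; exact: martin_formulation.
exists (#|edges G| + (size (enum X) * (3 * #|edges G|) + s))%N; last first.
  rewrite -cardE; have := connected_edge_bound ab endsE G_connected; move: sle; lia.
suff <- : (base `&` (martin `&` W))%classic = sp_trees_polytope R G by [].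
have conn := graph_connected ab endsE G_connected.
apply/seteqP; split; last first.
  apply: smallest_sub; first exact: formulation_convex ext.
  move=> _ [T Ttree <-]; have [iK cK] := spanning_tree_indep ab endsE Ttree.
  set K := [set i | _] in iK cK; have chiE : char_vector R T = \col_i (i \in K)%:R.
    by apply/matrixP => i j; rewrite !mxE inE.
  rewrite chiE; split; [split|split].
  - by move=> i; rewrite mxE ler0n.
  - rewrite -(tree_card iK cK) -[in RHS](setIT K) -sum_indicator.
    by apply: eq_big => i; [rewrite in_setT | rewrite mxE].
  - move=> r _; have toR x : exists2 u, u \in [set r] & connect (adj a b K) x u.
      by exists r; rewrite ?inE.
    have [pa [pb [pK outp]]] := tree_parents (indep_root iK) toR.
    exists (fun e => (pa e)%:R), (fun e => (pb e)%:R); split=> [e|e|e|v].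
    + exact: ler0n.
    + exact: ler0n.
    + by rewrite mxE -natrD pK.
    + by rewrite out_natr outp inE.
  - exact: Wtree.
move=> x [[x0 sumx] [xM xW]].
have bounds : forest_bounds a b (fun i => x i 0).
  split=> // S u uS; have [[r /andP[rS rX]]|noX] := pselect (exists r, (r \in S) && (r \in X)).
    have [|pa [pb [pa0 pb0 xp outp]]] := xM r; first by rewrite mem_enum.
    apply: le_trans (rooted_bound pa0 pb0 outp rS); apply: ler_sum => e _; exact: xp.
  apply: (Wsound x S u xW uS) => v vS; apply/negP => vX; apply: noX.
  by exists v; rewrite vS.
have -> : x = \col_i x i 0 by apply/matrixP => i j; rewrite mxE ord1.
move=> C [/= convC subC].
apply: (spanning_tree_polytope (C := fun y => C (\col_i y i)) conn bounds sumx) => [y z t t01 Cy Cz|K iK cK].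
  have t01' : Itv.spec (@Itv.num_sem R) (Itv.Real `[0%Z, 1%Z]) t.
    by case/andP: t01 => t0 t1; rewrite /= /Itv.num_sem /= num_real /= in_itv /= t0 t1.
  have /set_mem := convC (\col_i y i) (\col_i z i) (Itv.mk t01') (mem_set Cy) (mem_set Cz).
  congr C.
  by apply/matrixP => i j; rewrite !mxE.
have [Ttree memT] := indep_spanning_tree ab endsE iK cK.
apply: subC; exists [set enum_val i | i in K] => //.
by apply/matrixP => i j; rewrite !mxE memT.
Qed.

End ApexBounds.

Theorem theorem4 (R : realType) :
  exists C C' : R,
    [/\ 0 < C, 0 < C' &
        forall (k : nat) (G : sgraph),
          (1 <= k)%N -> is_connected G -> apex R k G ->
          (xc (sp_trees_polytope R G) <= (C * k%:R * #|edges G|%:R)%:E)%E /\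
          C * k%:R * #|edges G|%:R <= C' * k%:R ^+ 2 * #|G|%:R].
Proof.
(* The formulation has at most [(17 + 3k)|E|] inequalities, and [|E| <= (k + 3)|V|]. *)
exists 20, 80; split; [by [] | by [] | move=> k G k1 G_conn [X [Xk H_planar]]; split].
  have [s ext sle] := apex_formulation G_conn H_planar.
  apply: le_trans (xc_le ext) _; rewrite lee_fin -!natrM ler_nat.
  apply: leq_trans sle _; rewrite leq_mul2r; apply/orP; right; lia.
have := apex_edge_bound H_planar; rewrite -!natrM -natrX -!natrM ler_nat => le_E.
apply: (@leq_trans (20 * k * (4 * k * #|G|))); last by rewrite expnS expn1; lia.
rewrite leq_mul2l; apply/orP; right; apply: leq_trans le_E _.
apply: (@leq_trans (k * #|G| + 3 * #|G|)).
  by rewrite leq_add ?leq_mul2r ?Xk ?orbT // leq_mul2l leq_pred.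
by rewrite -mulnDl leq_mul2r; apply/orP; right; lia.
Qed.
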